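(* Let $D\in\{\mathbb{D},\mathbb{H}\}$ and $\tau\in\partial D$. Let $(v_{s,t})_{(s,t)\in\Delta(I)}\subset\mathfrak{U}_\tau$ be a topological reverse evolution family. If there exists $z_0\in D$ such that the map $I\ni t\mapsto v_{0,t}(z_0)$ belongs to $AC_{\mathrm{loc}}(I)$, then the reverse evolution family $(v_{s,t})$ is absolutely continuous.
   Context: $\mathbb{D}:=\{z\colon|z|<1\}$, $\mathbb{H}:=\{z\colon\operatorname{Re}z>0\}$; the boundary $\partial\mathbb{H}$ is taken in the Riemann sphere, so $\infty\in\partial\mathbb{H}$. $\mathsf{Hol}(D,D)$ is the set of holomorphic self-maps of $D$ with the topology of locally uniform convergence. Boundary fixed points: $\sigma\in\partial D$ is a boundary fixed point of $w\in\mathsf{Hol}(D,D)$ if the angular limit of $w$ at $\sigma$ equals $\sigma$; it is regular (BRFP) if the angular derivative $w'(\sigma)$ is finite, where $w'(\sigma):=\angle\lim_{z\to\sigma}\frac{w(z)-\sigma}{z-\sigma}$ for $\sigma\ne\infty$; for $\sigma=\infty\in\partial\mathbb{H}$ one puts $w'(\infty):=\angle\lim_{z\to\infty}w(z)/z$ (which always exists in $[0,+\infty)$), and $\infty$ is a BRFP iff $w'(\infty)\ne0$. For $w\in\mathsf{Hol}(D,D)$ without fixed points in $D$, the Denjoy–Wolff point (DW-point) is the unique BRFP $\tau\in\partial D$ with $w'(\tau)\le1$ if $\tau\ne\infty$, and $w'(\tau)\ge1$ if $\tau=\infty$. For $\tau\in\partial D$, $\mathfrak{U}_\tau$ denotes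 the set consisting of $\mathrm{id}_D$ and all $v\in\mathsf{Hol}(D,D)$ for which $\tau$ is the DW-point. $I\subset\mathbb{R}$ is an interval of the form $[0,T]$ with $T\in(0,+\infty)$ or $[0,T)$ with $T\in(0,+\infty]$; $\Delta(I):=\{(s,t)\colon s,t\in I,\ s\le t\}$; $AC_{\mathrm{loc}}(I)$ is the class of real- or complex-valued functions on $I$ absolutely continuous on each compact subinterval of $I$; $L^1_{\mathrm{loc}}(I)$ is the class of measurable functions on $I$ integrable on each compact subinterval. An absolutely continuous reverse evolution family in $D$ over $I$ is a family $(v_{s,t})_{(s,t)\in\Delta(I)}\subset\mathsf{Hol}(D,D)$ such that: REF1: $v_{s,s}=\mathrm{id}_D$ for all $s\in I$; REF2: $v_{s,u}=v_{s,t}\circ v_{t,u}$ whenever $s\le t\le u$ in $I$; REF3: for each $z\in D$ there is a non-negative $f_z\in L^1_{\mathrm{loc}}(I)$ with $|v_{s,u}(z)-v_{s,t}(z)|\le\int_t^u f_z(r)\,\mathrm{d}r$ whenever $s\le t\le u$ in $I$. A topological reverse evolution family is a family satisfying REF1, REF2 and such that the map $\Delta(I)\ni(s,t)\mapsto v_{s,t}\in\mathsf{Hol}(D,D)$ is continuous. *)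

(* Defs.v *)
From HB Require Import structures.
From mathcomp Require Import all_boot all_order all_algebra.
From mathcomp Require Import complex.
From mathcomp Require Import all_classical all_reals all_analysis.
Set Implicit Arguments.
Unset Strict Implicit.
Unset Printing Implicit Defensive.
Import Order.TTheory GRing.Theory Num.Theory.
Import numFieldNormedType.Exports.
Local Open Scope classical_set_scope.
Local Open Scope ring_scope.
Local Open Scope complex_scope.

(* Packing R[i] as a numClosedFieldType gives it the norm and topology that the
   library attaches to numFieldTypes.  Norms are C-valued, and [x <= y] in C
   entails that y - x is real. *)
Definition C (R : realType) : numClosedFieldType := R[i].

Definition sphere (R : realType) : topologicalType :=
  one_point_compactification (C R).

Inductive domain := Disk | HalfPlane.

Definition carrier (R : realType) (D : domain) : set (C R) :=
  match D with
  | Disk => [set z | `|z| < 1]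
  | HalfPlane => [set z | 0 < complex.Re z]
  end.

(* The topological boundary in the Riemann sphere, so that the point at
   infinity [None] belongs to the boundary of the half-plane. *)
Definition bd (R : realType) (D : domain) : set (sphere R) :=
  let A : set (sphere R) := [set Some z | z in carrier (R := R) D] in
  closure A `\` interior A.

Definition holo_self (R : realType) (D : domain) (w : C R -> C R) : Prop :=
  (forall z, carrier D z -> carrier D (w z)) /\
  (forall z, carrier D z -> derivable w z 1).

(* Distance from a point of the domain to the complement of the domain. *)
Definition bd_dist (R : realType) (D : domain) (z : C R) : C R :=
  match D with
  | Disk => 1 - `|z|
  | HalfPlane => (complex.Re z)%:C
  end.

(* Non-tangential approach region of aperture M.  At infinity in the half-plane
   it is the sector |z| <= M Re z; at a finite boundary point of the half-plane
   it is the translate of that sector; in the disk it is the region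
   |z - s| <= M (1 - |z|). *)
Definition stolz (R : realType) (D : domain) (sigma : sphere R) (M : R) :
    set (C R) :=
  [set z | carrier D z /\
     (if sigma is Some s then `|z - s| else `|z|) <= M%:C * bd_dist D z].

(* Pulling the neighbourhoods of sigma back along C -> sphere treats finite
   points and infinity uniformly. *)
Definition angular_nbhs (R : realType) (D : domain) (sigma : sphere R) (M : R) :
    set_system (C R) :=
  within (stolz D sigma M)
    (filter_from (nbhs sigma) (fun U : set (sphere R) => Some @^-1` U)).

Definition angular_limit (R : realType) (T : topologicalType) (D : domain)
    (f : C R -> T) (sigma : sphere R) (l : T) : Prop :=
  forall M : R, f @ angular_nbhs D sigma M --> l.

Definition boundary_fixed_point (R : realType) (D : domain) (w : C R -> C R)
    (sigma : sphere R) : Prop :=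
  bd D sigma /\ angular_limit D (fun z => Some (w z) : sphere R) sigma sigma.

Definition angular_derivative (R : realType) (D : domain) (w : C R -> C R)
    (sigma : sphere R) (a : C R) : Prop :=
  if sigma is Some s then
    angular_limit D (fun z => (w z - s) / (z - s)) sigma a
  else angular_limit D (fun z => w z / z) sigma a.

Definition BRFP (R : realType) (D : domain) (w : C R -> C R)
    (sigma : sphere R) : Prop :=
  boundary_fixed_point D w sigma /\
  exists a : C R, angular_derivative D w sigma a /\
    (if sigma is None then a != 0 else True).

(* At most one boundary point has this property, by the Denjoy-Wolff theorem. *)
Definition DW_point (R : realType) (D : domain) (w : C R -> C R)
    (tau : sphere R) : Prop :=
  [/\ forall z, carrier D z -> w z != z,
      BRFP D w tau &
      exists a : C R, angular_derivative D w tau a /\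
        (if tau is Some _ then a <= 1 else 1 <= a)].

Definition U_class (R : realType) (D : domain) (tau : sphere R)
    (w : C R -> C R) : Prop :=
  (forall z, carrier D z -> w z = z) \/ (holo_self D w /\ DW_point D w tau).

Definition time_interval (R : realType) (I : set R) : Prop :=
  (exists2 T : R, 0 < T & I = [set t | 0 <= t <= T]) \/
  (exists2 T : \bar R, (0 < T)%E & I = [set t | 0 <= t /\ (t%:E < T)%E]).

Definition Delta (R : realType) (I : set R) : set (R * R) :=
  [set p | [/\ I p.1, I p.2 & p.1 <= p.2]].

Definition AC_on (R : realType) (a b : R) (f : R -> C R) : Prop :=
  forall eps : R, 0 < eps -> exists2 delta : R, 0 < delta &
    forall (n : nat) (x y : 'I_n -> R),
      (forall i, [/\ a <= x i, x i <= y i & y i <= b]) ->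
      (forall i j, i != j -> y i <= x j \/ y j <= x i) ->
      \sum_(i < n) (y i - x i) < delta ->
      \sum_(i < n) `|f (y i) - f (x i)| < eps%:C.

Definition AC_loc (R : realType) (I : set R) (f : R -> C R) : Prop :=
  forall a b : R, `[a, b] `<=` I -> AC_on a b f.

Definition L1_loc (R : realType) (I : set R) (f : R -> R) : Prop :=
  measurable_fun I f /\
  forall a b : R, `[a, b] `<=` I ->
    (@lebesgue_measure R).-integrable `[a, b] (EFin \o f).

(* A family [v] is only meaningful at times (s, t) in Delta I and at points of
   the domain; its other values are arbitrary. *)
Definition REF_maps (R : realType) (D : domain) (I : set R)
    (v : R -> R -> C R -> C R) : Prop :=
  forall s t, Delta I (s, t) -> holo_self D (v s t).

Definition REF1 (R : realType) (D : domain) (I : set R)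
    (v : R -> R -> C R -> C R) : Prop :=
  forall s, I s -> forall z, carrier D z -> v s s z = z.

Definition REF2 (R : realType) (D : domain) (I : set R)
    (v : R -> R -> C R -> C R) : Prop :=
  forall s t u, Delta I (s, t) -> Delta I (t, u) ->
    forall z, carrier D z -> v s u z = v s t (v t u z).

Definition REF3 (R : realType) (D : domain) (I : set R)
    (v : R -> R -> C R -> C R) : Prop :=
  forall z, carrier D z ->
    exists f : R -> R, [/\ forall r, I r -> 0 <= f r, L1_loc I f &
      forall s t u, Delta I (s, t) -> Delta I (t, u) ->
        `|v s u z - v s t z|
          <= (\int[@lebesgue_measure R]_(r in `[t, u]) f r)%:C].

Definition absolutely_continuous_REF (R : realType) (D : domain) (I : set R)
    (v : R -> R -> C R -> C R) : Prop :=
  [/\ REF_maps D I v, REF1 D I v, REF2 D I v & REF3 D I v].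

(* On maps of the domain, {family compactly_in D, _ -> _} is the topology of
   uniform convergence on compact subsets of the domain, that is, of locally
   uniform convergence. *)
Definition topological_REF (R : realType) (D : domain) (I : set R)
    (v : R -> R -> C R -> C R) : Prop :=
  [/\ REF_maps D I v, REF1 D I v, REF2 D I v &
    {within Delta I, continuous (fun p : R * R =>
       v p.1 p.2 : {family compactly_in (carrier (R := R) D), C R -> C R})}].

(* Main.v *)
(** A Moebius map carries [D] to the right half-plane and [tau] to infinity.  There
    Julia's lemma turns the Denjoy-Wolff condition into [Re z <= Re (v s t z)], so
    that every increment [v s t - id] has nonnegative real part, and Harnack's
    inequality bounds it at an arbitrary point by its value at [z0].  The
    Schwarz-Pick inequality makes an increment Lipschitz with a constant
    proportional to its size; hence [v s t] shrinks distances at most by a factor 2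
    for [t - s] small, and, splitting [0, t] into short pieces, the displacement of
    [z0] under [v t u] is at most a constant times [|v 0 u z0 - v 0 t z0|].  Thus
    [|v s u z - v s t z| <= K |v 0 u z0 - v 0 t z0|] on every compact interval, and
    an absolutely continuous orbit has an integrable density (Radon-Nikodym for the
    Stieltjes measure of its variation function).

    Schwarz-Pick is obtained without contour integrals: Goursat's bisection is run
    on Riemann sums over squares, and a maximum principle with a constant, applied
    to powers, suffices. *)
From HB Require Import structures.
Require Import Defs.
From mathcomp Require Import all_boot all_order all_algebra.
From mathcomp Require Import complex.
From mathcomp Require Import all_classical all_reals all_analysis.
From mathcomp Require Import measurable_realfun ring lra.
Set Implicit Arguments.
Unset Strict Implicit.
Unset Printing Implicit Defensive.
Import Order.TTheory GRing.Theory Num.Theory.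
Import numFieldNormedType.Exports.
Local Open Scope classical_set_scope.
Local Open Scope ring_scope.
Local Open Scope complex_scope.

(** * The modulus on [C R] as a real number *)

Section Modulus.
Variable R : realType.
Implicit Types z w a b : C R.

(** The hypothesis controls a single orbit started at time 0, while the conclusion concerns
    [v s u z - v s t z] for every [s]. Since [v 0 u z0 = v 0 t (v t u z0)], the displacement of [z0]
    under [v t u] has to be recovered through [v 0 t], against the contraction of self-maps. What
    makes this possible is that Schwarz-Pick applies to the increment [v s t - id] itself, a
    holomorphic function of nonnegative real part: where it is small it has a small Lipschitz
    constant, and the identity plus such a function cannot contract much. Continuity in time,
    uniform on compact intervals, bounds the number of short pieces, hence the product of the
    factors 2. The resulting constant depends on the compact interval and may grow without bound
    towards the end of a half-open [I]; therefore densities are built on successive compact pieces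
    and glued. *)

Definition cabs (z : C R) : R := complex.Re `|z|.

Lemma cabsE z : `|z| = (cabs z)%:C.
Proof. by rewrite /cabs RRe_real // normr_real. Qed.

Lemma cabsM z w : cabs (z * w) = cabs z * cabs w.
Proof. by apply: complexI; rewrite rmorphM /= -!cabsE normrM. Qed.

Lemma cabsD z w : cabs (z + w) <= cabs z + cabs w.
Proof. by rewrite -lecR rmorphD /= -!cabsE; exact: ler_normD. Qed.

Lemma cabsN z : cabs (- z) = cabs z.
Proof. by rewrite /cabs normrN. Qed.

Lemma cabsB z w : cabs (z - w) <= cabs z + cabs w.
Proof. by rewrite -(cabsN w); exact: cabsD. Qed.

Lemma cabsC z w : cabs (z - w) = cabs (w - z).
Proof. by rewrite -cabsN opprB. Qed.

Lemma cabs_ge0 z : 0 <= cabs z.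
Proof. by rewrite -lecR -cabsE; exact: normr_ge0. Qed.

Lemma cabs_gt0 z : (0 < cabs z) = (z != 0).
Proof. by rewrite -ltcR -cabsE normr_gt0. Qed.

Lemma cabs0 : cabs (0 : C R) = 0.
Proof. by rewrite /cabs normr0. Qed.

Lemma cabs1 : cabs (1 : C R) = 1.
Proof. by rewrite /cabs normr1. Qed.

Lemma cabs_eq0 z : (cabs z == 0) = (z == 0).
Proof.
by apply/idP/idP => [|/eqP->]; [apply: contraLR; rewrite -cabs_gt0; case: ltgtP|rewrite cabs0].
Qed.

Lemma cabsV z : cabs z^-1 = (cabs z)^-1.
Proof. by apply: complexI; rewrite fmorphV /= -!cabsE normfV. Qed.

Lemma cabsX z n : cabs (z ^+ n) = cabs z ^+ n.
Proof. by elim: n => [|n IH]; rewrite ?expr0 ?cabs1 // !exprS cabsM IH. Qed.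

Lemma sqr_cabs z : cabs z ^+ 2 = complex.Re z ^+ 2 + complex.Im z ^+ 2.
Proof. by apply: complexI; rewrite rmorphXn /= -cabsE -add_Re2_Im2. Qed.

Lemma cabs_Re z : `|complex.Re z| <= cabs z.
Proof. by rewrite -lecR -cabsE; exact: normc_ge_Re. Qed.

Lemma Re_cabs z : complex.Re z <= cabs z.
Proof. exact: le_trans (ler_norm _) (cabs_Re z). Qed.

Lemma cabs_conj z : cabs z^*%C = cabs z.
Proof. by apply: complexI; rewrite -!cabsE; exact: normcJ. Qed.

Lemma cabs_real (x : R) : cabs (x%:C : C R) = `|x|.
Proof. by rewrite /cabs normc_def /= expr0n addr0 sqrtr_sqr. Qed.

Lemma cabs2 : cabs (2 : C R) = 2.
Proof.
by rewrite -[2]/(2%:R) -(rmorph_nat (real_complex R)) cabs_real ger0_norm.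
Qed.

Lemma cabs_i : cabs ('i : C R) = 1.
Proof. by rewrite /cabs normc_def /= expr0n add0r expr1n sqrtr1. Qed.

Lemma cabs_le_ReIm z : cabs z <= `|complex.Re z| + `|complex.Im z|.
Proof.
rewrite {1}(complexE z); apply: le_trans (cabsD _ _) _.
by rewrite cabsM cabs_i mul1r (cabs_real (complex.Re z)) (cabs_real (complex.Im z)).
Qed.

Lemma Re_add z w : complex.Re (z + w) = complex.Re z + complex.Re w.
Proof. by case: z w => ? ? []. Qed.
Lemma Im_add z w : complex.Im (z + w) = complex.Im z + complex.Im w.
Proof. by case: z w => ? ? []. Qed.
Lemma Re_opp z : complex.Re (- z) = - complex.Re z.
Proof. by case: z. Qed.
Lemma Im_opp z : complex.Im (- z) = - complex.Im z.
Proof. by case: z. Qed.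
Lemma Re_mul z w : complex.Re (z * w) =
  complex.Re z * complex.Re w - complex.Im z * complex.Im w.
Proof. by case: z w => ? ? []. Qed.
Lemma Im_mul z w : complex.Im (z * w) =
  complex.Re z * complex.Im w + complex.Im z * complex.Re w.
Proof. by case: z w => ? ? []. Qed.
Lemma Re_conj z : complex.Re z^*%C = complex.Re z.
Proof. by case: z. Qed.
Lemma Im_conj z : complex.Im z^*%C = - complex.Im z.
Proof. by case: z. Qed.
Lemma Re_inv z : complex.Re z^-1 = complex.Re z / cabs z ^+ 2.
Proof. by rewrite sqr_cabs; case: z => a b. Qed.
Lemma Im_inv z : complex.Im z^-1 = - complex.Im z / cabs z ^+ 2.
Proof. by rewrite sqr_cabs; case: z => a b /=; rewrite mulNr. Qed.

Definition ReImE := (Re_add, Im_add, Re_opp, Im_opp, Re_mul, Im_mul, Re_conj, Im_conj).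

Definition ccont (f : C R -> C R) a := forall e : R, 0 < e ->
  exists2 d : R, 0 < d & forall z, cabs (z - a) < d -> cabs (f z - f a) < e.

(* Caratheodory's form of complex differentiability: sums, products and
   quotients, as well as removable singularities, are read off the factor. *)
Definition cdiff (f : C R -> C R) a :=
  exists2 p : C R -> C R, ccont p a &
    forall z, f z - f a = p z * (z - a).

End Modulus.

(** * Goursat's lemma *)

Section Goursat.
Variable R : realType.
Implicit Types (f g : C R -> C R) (z h s : C R).

(* The average of [f] over the [2 ^ n] equidistant left endpoints of the segment
   from [z] to [z + h]; [h * seg_avg f n z h] is a Riemann sum. *)
Fixpoint seg_avg f n z h : C R :=
  if n is n'.+1 then
    (seg_avg f n' z (h / 2) + seg_avg f n' (z + h / 2) (h / 2)) / 2
  else f z.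

(** Repeated midpoints of values of [f] never leave a midpoint-closed set. Applied to discs this
    bounds the averages, applied to half-planes it bounds their real or imaginary parts on one
    side. *)
Lemma seg_avg_convex (S : C R -> Prop) f n z h :
  (forall a b, S a -> S b -> S ((a + b) / 2)) ->
  (forall t : R, 0 <= t <= 1 -> S (f (z + t%:C * h))) -> S (seg_avg f n z h).
Proof.
move=> cS; elim: n z h => [|n IH] z h Sf /=.
  by have := Sf 0; rewrite mul0r addr0; apply; rewrite lexx ler01.
apply: cS; apply: IH => t /andP[t0 t1].
- have -> : t%:C * (h / 2) = (t / 2)%:C * h.
    by rewrite rmorphM /= fmorphV rmorph_nat; ring.
  by apply: Sf; lra.
- have -> : z + h / 2 + t%:C * (h / 2) = z + ((t + 1) / 2)%:C * h.
    by rewrite rmorphM rmorphD rmorph1 /= fmorphV rmorph_nat; field.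
  by apply: Sf; lra.
Qed.

Lemma seg_avg_lin f g c n z h :
  seg_avg (fun w => f w + c * g w) n z h = seg_avg f n z h + c * seg_avg g n z h.
Proof. by elim: n z h => [//|n IH] z h /=; rewrite !IH; field. Qed.

Lemma seg_avg_le f n z h (M : R) :
  (forall t : R, 0 <= t <= 1 -> cabs (f (z + t%:C * h)) <= M) ->
  cabs (seg_avg f n z h) <= M.
Proof.
apply: (seg_avg_convex (S := fun w => cabs w <= M)) => a b aM bM.
rewrite cabsM cabsV cabs2.
by have := cabsD a b; lra.
Qed.

(* [s * sq_sum f n z s] is the Riemann sum of [f] along the boundary of the
   square with lower left corner [z] and side [s]. *)
Definition sq_sum f n z s : C R :=
  seg_avg f n z s + 'i * seg_avg f n (z + s) ('i * s)
  - seg_avg f n (z + 'i * s) s - 'i * seg_avg f n z ('i * s).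

(** The sums along sides shared by two quarter squares cancel exactly. The factor 1/2 is the ratio
    of the sides, which [sq_sum] leaves out. *)
Lemma sq_sumS f n z s : sq_sum f n.+1 z s =
  (sq_sum f n z (s / 2) + sq_sum f n (z + s / 2) (s / 2)
   + sq_sum f n (z + 'i * (s / 2)) (s / 2)
   + sq_sum f n (z + s / 2 + 'i * (s / 2)) (s / 2)) / 2.
Proof.
rewrite /sq_sum /=.
have -> : 'i * s / 2 = 'i * (s / 2) :> C R by ring.
have -> : z + s / 2 + s / 2 = z + s by field.
have -> : z + 'i * (s / 2) + 'i * (s / 2) = z + 'i * s :> C R by field.
have -> : z + s / 2 + 'i * (s / 2) + 'i * (s / 2) = z + 'i * s + s / 2 :> C R
  by field.
have -> : z + s / 2 + 'i * (s / 2) + s / 2 = z + s + 'i * (s / 2) :> C R by field.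
have -> : z + 'i * (s / 2) + s / 2 = z + s / 2 + 'i * (s / 2) :> C R by field.
by field.
Qed.

(** The corner values already give 0 at level 0, because the errors of the left endpoint rule cancel
    between opposite sides. Hence no limit in [n] is needed to discard the affine part of a
    function. *)
Lemma sq_sum_affine (a b : C R) n z s : sq_sum (fun w => a + b * w) n z s = 0.
Proof.
elim: n z s => [|n IH] z s; last by rewrite sq_sumS !IH !addr0 mul0r.
rewrite /sq_sum /=.
suff -> : a + b * z + 'i * (a + b * (z + s)) - (a + b * (z + 'i * s)) -
  'i * (a + b * z) = 0 :> C R by [].
by ring.
Qed.

Lemma sq_sum_lin f g c n z s :
  sq_sum (fun w => f w + c * g w) n z s = sq_sum f n z s + c * sq_sum g n z s.
Proof. by rewrite /sq_sum !seg_avg_lin; ring. Qed.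

Definition in_square z (s : R) : set (C R) :=
  [set w | complex.Re z <= complex.Re w <= complex.Re z + s /\
           complex.Im z <= complex.Im w <= complex.Im z + s].

Definition square_bd z (s : R) : set (C R) :=
  [set w | in_square z s w /\
    [\/ complex.Im w = complex.Im z, complex.Re w = complex.Re z + s,
        complex.Im w = complex.Im z + s | complex.Re w = complex.Re z]].

Lemma sq_sum_le f n z (s M : R) : 0 <= s ->
  (forall w, square_bd z s w -> cabs (f w) <= M) ->
  cabs (sq_sum f n z s%:C) <= 4 * M.
Proof.
move=> s0 fM; rewrite /sq_sum.
have le1 (t : R) : 0 <= t <= 1 -> 0 <= t * s <= s.
  by move=> /andP[t0 t1]; rewrite mulr_ge0 //= ler_piMl.
have h1 : cabs (seg_avg f n z s%:C) <= M.
  apply: seg_avg_le => t /le1 ts; apply: fM; rewrite /square_bd /in_square /= !ReImE /=.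
  split; first lra.
  by apply: Or41; lra.
have h2 : cabs (seg_avg f n (z + s%:C) ('i * s%:C)) <= M.
  apply: seg_avg_le => t /le1 ts; apply: fM; rewrite /square_bd /in_square /= !ReImE /=.
  split; first lra.
  by apply: Or42; lra.
have h3 : cabs (seg_avg f n (z + 'i * s%:C) s%:C) <= M.
  apply: seg_avg_le => t /le1 ts; apply: fM; rewrite /square_bd /in_square /= !ReImE /=.
  split; first lra.
  by apply: Or43; lra.
have h4 : cabs (seg_avg f n z ('i * s%:C)) <= M.
  apply: seg_avg_le => t /le1 ts; apply: fM; rewrite /square_bd /in_square /= !ReImE /=.
  split; first lra.
  by apply: Or44; lra.
apply: le_trans (cabsB _ _) _; rewrite cabsM cabs_i mul1r.
have := cabsB (seg_avg f n z s%:C + 'i * seg_avg f n (z + s%:C) ('i * s%:C))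
  (seg_avg f n (z + 'i * s%:C) s%:C).
have := cabsD (seg_avg f n z s%:C) ('i * seg_avg f n (z + s%:C) ('i * s%:C)).
by rewrite cabsM cabs_i mul1r; lra.
Qed.

(** Up to an affine function, [f w] is [(p w - p a) * (w - a)], at most [e / 8 * (2 * s)] on the
    boundary; the four sides give the factor 4. The bound holds for all [n] at once, which is what
    contradicts the bisection. *)
Lemma sq_sum_cdiff f a (e : R) : cdiff f a -> 0 < e ->
  exists2 d : R, 0 < d & forall z (s : R), 0 <= s < d -> in_square z s a ->
    forall n, cabs (sq_sum f n z s%:C) <= e * s.
Proof.
move=> [p cp fp] e0.
have [|d d0 pd] := cp (e / 8); first by lra.
exists (d / 2) => [|z s /andP[s0 sd] [zr zi] n]; first by lra.
have fE : f = (fun w => (f a - p a * a + p a * w) + 1 * ((p w - p a) * (w - a))).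
  by apply/funext => w; have := fp w => /eqP; rewrite subr_eq => /eqP ->; ring.
rewrite fE sq_sum_lin sq_sum_affine add0r mul1r.
have -> : e * s = 4 * (e / 8 * (2 * s)) by lra.
apply: sq_sum_le => // w [[wr wi] _].
have wa : cabs (w - a) <= 2 * s.
  apply: le_trans (cabs_le_ReIm _) _; rewrite !ReImE.
  have : `|complex.Re w - complex.Re a| <= s by rewrite ler_norml; lra.
  have : `|complex.Im w - complex.Im a| <= s by rewrite ler_norml; lra.
  by lra.
rewrite cabsM ler_pM ?cabs_ge0 //; apply: ltW; apply: pd; lra.
Qed.

Lemma nested_intervals (x d : nat -> R) :
  (forall n, x n <= x n.+1) -> (forall n, x n.+1 + d n.+1 <= x n + d n) ->
  (forall n, 0 <= d n) -> exists l, forall n, x n <= l <= x n + d n.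
Proof.
move=> xS xdS d0.
have xle m n : (m <= n)%N -> x m <= x n.
  by move=> /subnK <-; elim: (n - m)%N => // k /le_trans; apply; exact: xS.
have xdle m n : (m <= n)%N -> x n + d n <= x m + d m.
  by move=> /subnK <-; elim: (n - m)%N => // k; apply: le_trans; exact: xdS.
have ub n : ubound (range x) (x n + d n).
  move=> _ [m _ <-]; case: (leqP m n) => [/xle mn|/ltnW /xdle mn].
    by have := d0 n; lra.
  by have := d0 m; lra.
exists (sup (range x)) => n; apply/andP; split.
- by apply: ub_le_sup; [exists (x 0%N + d 0%N)|exists n].
- by apply: ge_sup; [exists (x 0%N), 0%N|exact: ub].
Qed.

(* Goursat's bisection argument, for Riemann sums instead of integrals. *)
Theorem sq_sum_cvg0 f z (s e : R) : 0 <= s -> 0 < e ->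
  (forall a, in_square z s a -> cdiff f a) ->
  exists N, forall n, (N <= n)%N -> cabs (sq_sum f n z s%:C) <= e * s.
Proof.
move=> s0 e0 fd; apply: contrapT.
(* The bound [e * s] is scaled so that four good quarters make a good square:
   [4 * (e * s / 2) / 2 = e * s]. *)
pose good z (s : R) := exists N, forall n, (N <= n)%N -> cabs (sq_sum f n z s%:C) <= e * s.
rewrite -/(good z s) => zs.
(* The premises stand inside the existential, so that [choice] gives a total successor function. *)
have step (u : C R * R) : exists u', 0 <= u.2 -> ~ good u.1 u.2 ->
    [/\ ~ good u'.1 u'.2, u'.2 = u.2 / 2,
      complex.Re u.1 <= complex.Re u'.1 <= complex.Re u.1 + u.2 / 2 &
      complex.Im u.1 <= complex.Im u'.1 <= complex.Im u.1 + u.2 / 2].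
  case: u => w t /=; pose h : C R := t%:C / 2.
  have hE : h = (t / 2)%:C by rewrite /h rmorphM /= fmorphV rmorph_nat.
  apply: contrapT => /forallNP nu.
  have [t0 wt] : 0 <= t /\ ~ good w t.
    by have := nu (w, t) => /not_implyP[? /not_implyP[? _]].
  apply: wt.
  have goodq w' : complex.Re w <= complex.Re w' <= complex.Re w + t / 2 ->
      complex.Im w <= complex.Im w' <= complex.Im w + t / 2 -> good w' (t / 2).
    move=> wr wi; apply: contrapT => gw.
    by have := nu (w', t / 2) => /not_implyP[_ /not_implyP[_]]; apply.
  have [N1 g1] : good w (t / 2) by apply: goodq; lra.
  have [N2 g2] : good (w + h) (t / 2).
    by apply: goodq; rewrite hE !ReImE /=; lra.
  have [N3 g3] : good (w + 'i * h) (t / 2).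
    by apply: goodq; rewrite hE !ReImE /=; lra.
  have [N4 g4] : good (w + h + 'i * h) (t / 2).
    by apply: goodq; rewrite hE !ReImE /=; lra.
  exists (N1 + N2 + N3 + N4).+1 => -[//|n]; rewrite ltnS => Nn.
  rewrite sq_sumS -/h hE.
  have /g1 {g1} : (N1 <= n)%N by apply: leq_trans Nn; rewrite -!addnA leq_addr.
  have /g2 {g2} : (N2 <= n)%N.
    by apply: leq_trans Nn; rewrite -!addnA addnCA leq_addr.
  have /g3 {g3} : (N3 <= n)%N.
    by apply: leq_trans Nn; rewrite addnAC leq_addl.
  have /g4 {g4} : (N4 <= n)%N by apply: leq_trans Nn; rewrite leq_addl.
  rewrite hE; set A := sq_sum _ _ _ _; set B := sq_sum _ _ _ _.
  set D := sq_sum _ _ _ _; set E := sq_sum _ _ _ _ => hE' hD hB hA.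
  rewrite cabsM cabsV cabs2.
  have := cabsD (E + D + B) A; have := cabsD (E + D) B; have := cabsD E D.
  by lra.
have [next nextP] := choice step.
pose u := fix u n := if n is n'.+1 then next (u n') else (z, s).
have uP n : 0 <= (u n).2 /\ ~ good (u n).1 (u n).2.
  by elim: n => [//|n [u0 gu]] /=; have [? u2 _ _] := nextP _ u0 gu; split=> //=; rewrite ?u2; lra.
have uS n : [/\ (u n.+1).2 = (u n).2 / 2,
    complex.Re (u n).1 <= complex.Re (u n.+1).1 <= complex.Re (u n).1 + (u n).2 / 2 &
    complex.Im (u n).1 <= complex.Im (u n.+1).1 <= complex.Im (u n).1 + (u n).2 / 2].
  by have [u0 gu] := uP n; have [_ ? ? ?] := nextP _ u0 gu.
have [x xP] : exists x, forall n,
    complex.Re (u n).1 <= x <= complex.Re (u n).1 + (u n).2.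
  by apply: nested_intervals => n; have [e2 ? ?] := uS n; have [? _] := uP n;
    rewrite ?e2; lra.
have [y yP] : exists y, forall n,
    complex.Im (u n).1 <= y <= complex.Im (u n).1 + (u n).2.
  by apply: nested_intervals => n; have [e2 ? ?] := uS n; have [? _] := uP n;
    rewrite ?e2; lra.
have a_in n : in_square (u n).1 (u n).2 (x +i* y).
  by split => /=; [exact: xP|exact: yP].
have [d d0 fad] := sq_sum_cdiff (fd _ (a_in 0%N)) e0.
have un n : (u n).2 = s / 2 ^+ n.
  elim: n => [|n IH]; first by rewrite divr1.
  by have [-> _ _] := uS n; rewrite IH exprS; field.
have [n nd] : exists n, s / 2 ^+ n < d.
  have [n sdn] : exists n : nat, s / d < n%:R.
    by exists (Num.Def.archi_bound (s / d)); apply: archi_boundP; rewrite divr_ge0 // ltW.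
  exists n; rewrite ltr_pdivrMr ?exprn_gt0 // mulrC -ltr_pdivrMr //.
  apply: lt_trans sdn _; rewrite -natrX ltr_nat; exact: ltn_expl.
have [u0 gu] := uP n; apply: gu; exists 0%N => m _; apply: fad => //.
by rewrite u0 un.
Qed.

End Goursat.

(** * Calculus with Caratheodory's factor *)

Section ComplexDifferentiable.
Variable R : realType.
Implicit Types (f g p q : C R -> C R) (a : C R).

Lemma ccont_cst (c : C R) a : ccont (fun=> c) a.
Proof. by move=> e e0; exists 1 => // z _; rewrite subrr cabs0. Qed.

Lemma ccont_id a : ccont id a.
Proof. by move=> e e0; exists e. Qed.

Lemma ccontD f g a : ccont f a -> ccont g a -> ccont (fun z => f z + g z) a.
Proof.
move=> cf cg e e0; have e2 : 0 < e / 2 by lra.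
have [d1 d10 h1] := cf _ e2; have [d2 d20 h2] := cg _ e2.
exists (Num.min d1 d2) => [|z]; first by rewrite lt_min d10.
rewrite lt_min => /andP[/h1 ? /h2 ?].
have -> : f z + g z - (f a + g a) = (f z - f a) + (g z - g a) by ring.
by apply: le_lt_trans (cabsD _ _) _; lra.
Qed.

Lemma ccontM f g a : ccont f a -> ccont g a -> ccont (fun z => f z * g z) a.
Proof.
move=> cf cg e e0; have fa0 := cabs_ge0 (f a); have ga0 := cabs_ge0 (g a).
have [|d1 d10 h1] := cf (e / (2 * (cabs (g a) + 1))); first by rewrite divr_gt0 //; lra.
have [|d2 d20 h2] := cg (Num.min 1 (e / (2 * (cabs (f a) + 1)))).
  by rewrite lt_min ltr01 divr_gt0 //; lra.
exists (Num.min d1 d2) => [|z]; first by rewrite lt_min d10.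
rewrite lt_min => /andP[/h1 fz /h2]; rewrite lt_min => /andP[g1 gz].
have -> : f z * g z - f a * g a = (f z - f a) * g z + f a * (g z - g a) by ring.
apply: le_lt_trans (cabsD _ _) _; rewrite !cabsM.
have gz1 : cabs (g z) <= cabs (g a) + 1.
  have -> : g z = g a + (g z - g a) by ring.
  by apply: le_trans (cabsD _ _) _; lra.
rewrite ltr_pdivlMr in fz; last by lra.
rewrite ltr_pdivlMr in gz; last by lra.
have : cabs (f z - f a) * cabs (g z) <= cabs (f z - f a) * (cabs (g a) + 1).
  by rewrite ler_wpM2l // cabs_ge0.
have : cabs (f a) * cabs (g z - g a) <= (cabs (f a) + 1) * cabs (g z - g a).
  by rewrite ler_wpM2r ?cabs_ge0 //; lra.
by lra.
Qed.

Lemma ccontN f a : ccont f a -> ccont (fun z => - f z) a.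
Proof.
move=> fa; have := ccontM (ccont_cst (-1) a) fa.
by under eq_fun do rewrite mulN1r.
Qed.

Lemma ccont_ge f a : f a != 0 -> ccont f a ->
  exists2 d : R, 0 < d & forall z, cabs (z - a) < d -> cabs (f a) / 2 < cabs (f z).
Proof.
rewrite -cabs_gt0 => fa0 cf; have [|d d0 h] := cf (cabs (f a) / 2); first by lra.
exists d => // z /h fz; have := cabsD (f z) (f a - f z).
by rewrite addrC subrK cabsC; lra.
Qed.

Lemma ccontV f a : f a != 0 -> ccont f a -> ccont (fun z => (f z)^-1) a.
Proof.
move=> fa0 cf e e0; have [d1 d10 h1] := ccont_ge fa0 cf.
have fa_gt0 : 0 < cabs (f a) by rewrite cabs_gt0.
have [|d2 d20 h2] := cf (e * (cabs (f a) ^+ 2 / 2)).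
  by rewrite mulr_gt0 // divr_gt0 // exprn_gt0.
exists (Num.min d1 d2) => [|z]; first by rewrite lt_min d10.
rewrite lt_min => /andP[/h1 fz /h2 fza].
have fz_gt0 : 0 < cabs (f z) by lra.
have fz0 : f z != 0 by rewrite -cabs_gt0.
have -> : (f z)^-1 - (f a)^-1 = (f a - f z) / (f z * f a) by field; rewrite ?fa0 ?fz0.
rewrite cabsM cabsV cabsM ltr_pdivrMr ?mulr_gt0 // cabsC.
apply: lt_le_trans fza _; rewrite ler_pM2l //.
by rewrite expr2 mulrAC ler_pM2r //; lra.
Qed.

Lemma ccont_comp f g a : ccont g a -> ccont f (g a) -> ccont (fun z => f (g z)) a.
Proof.
move=> cg cf e e0; have [d d0 h] := cf _ e0; have [d' d'0 h'] := cg _ d0.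
by exists d' => // z /h'; exact: h.
Qed.

(** Away from [a] the difference quotient always serves as the factor, so only continuity at [a] is
    at stake. This admits factors such as that of [1 / f], which make sense only where [f] does not
    vanish. *)
Lemma cdiff_near f p a (d : R) : ccont p a -> 0 < d ->
  (forall z, cabs (z - a) < d -> f z - f a = p z * (z - a)) -> cdiff f a.
Proof.
move=> cp d0 fp; exists (fun z => if z == a then p a else (f z - f a) / (z - a)).
  move=> e e0; have [d' d'0 h] := cp _ e0.
  exists (Num.min d d') => [|z]; first by rewrite lt_min d0.
  rewrite lt_min eqxx => /andP[zd zd'].
  case: eqVneq => [_|za]; first by rewrite subrr cabs0.
  by rewrite fp // mulfK ?h // subr_eq0.
move=> z; case: eqVneq => [->|za]; first by rewrite !subrr mulr0.
by rewrite divfK // subr_eq0.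
Qed.

Lemma cdiff_ccont f a : cdiff f a -> ccont f a.
Proof.
move=> [p cp fp].
have -> : f = (fun z => f a + p z * (z - a)).
  by apply/funext => z; rewrite -fp addrC subrK.
apply: ccontD; first exact: ccont_cst.
by apply: ccontM => //; apply: ccontD; [exact: ccont_id|exact: ccont_cst].
Qed.

Lemma cdiff_cst (c : C R) a : cdiff (fun=> c) a.
Proof.
exists (fun=> 0); first exact: ccont_cst.
by move=> z; rewrite subrr mul0r.
Qed.

Lemma cdiff_id a : cdiff id a.
Proof.
exists (fun=> 1); first exact: ccont_cst.
by move=> z; rewrite mul1r.
Qed.

Lemma cdiffD f g a : cdiff f a -> cdiff g a -> cdiff (fun z => f z + g z) a.
Proof.
move=> [p cp fp] [q cq gq]; exists (fun z => p z + q z); first exact: ccontD.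
by move=> z; rewrite mulrDl -fp -gq; ring.
Qed.

Lemma cdiffM f g a : cdiff f a -> cdiff g a -> cdiff (fun z => f z * g z) a.
Proof.
move=> fa ga; have cf := cdiff_ccont fa.
move: fa ga => [p cp fp] [q cq gq].
exists (fun z => f z * q z + p z * g a).
  apply: ccontD; first exact: ccontM.
  by apply: ccontM => //; exact: ccont_cst.
move=> z.
have -> : (f z * q z + p z * g a) * (z - a) =
    f z * (q z * (z - a)) + p z * (z - a) * g a by ring.
by rewrite -fp -gq; ring.
Qed.

Lemma cdiffN f a : cdiff f a -> cdiff (fun z => - f z) a.
Proof.
move=> fa; have := cdiffM (cdiff_cst (-1) a) fa.
by under eq_fun do rewrite mulN1r.
Qed.

Lemma cdiffB f g a : cdiff f a -> cdiff g a -> cdiff (fun z => f z - g z) a.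
Proof. by move=> fa ga; apply: cdiffD => //; exact: cdiffN. Qed.

Lemma cdiffX f n a : cdiff f a -> cdiff (fun z => f z ^+ n) a.
Proof.
move=> fa; elim: n => [|n IH]; first exact: cdiff_cst.
by under eq_fun do rewrite exprS; exact: cdiffM.
Qed.

Lemma cdiffV f a : f a != 0 -> cdiff f a -> cdiff (fun z => (f z)^-1) a.
Proof.
move=> fa0 fa; have cf := cdiff_ccont fa; move: fa => [p cp fp].
have [d d0 fz] := ccont_ge fa0 cf.
apply: (cdiff_near (p := fun z => - p z * (f z * f a)^-1) _ d0).
  apply: ccontM; first exact: ccontN.
  apply: (ccontV (f := fun z => f z * f a)); first by rewrite mulf_neq0.
  by apply: ccontM => //; exact: ccont_cst.
move=> z /fz fz1; have fz0 : f z != 0.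
  by rewrite -cabs_gt0; move: fz1; have := cabs_ge0 (f a); lra.
have -> : - p z / (f z * f a) * (z - a) = - (p z * (z - a)) / (f z * f a).
  by ring.
by rewrite -fp; field; rewrite ?fa0 ?fz0.
Qed.

Lemma cdiff_comp f g a : cdiff g a -> cdiff f (g a) -> cdiff (fun z => f (g z)) a.
Proof.
move=> ga; have cg := cdiff_ccont ga; move: ga => [q cq gq] [p cp fp].
exists (fun z => p (g z) * q z).
  by apply: ccontM => //; exact: ccont_comp cp.
by move=> z; rewrite fp gq mulrA.
Qed.

Lemma derivable_cdiff f a : derivable f a 1 -> cdiff f a.
Proof.
move=> fa.
pose p z := if z == a then 'D_1 f a else (f z - f a) / (z - a).
exists p; last first.
  move=> z; rewrite /p; case: eqVneq => [->|za]; first by rewrite !subrr mulr0.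
  by rewrite divfK // subr_eq0.
have cfa : (fun h => h^-1 *: ((f \o shift a) (h *: 1) - f a)) @ 0^' --> 'D_1 f a.
  exact: fa.
move=> e e0.
have e0' : 0 < e%:C :> C R by rewrite ltcR.
move/cvgrPdist_lt : cfa => /(_ _ e0')[/= d d0 h].
have dE : d = (complex.Re d)%:C by rewrite RRe_real // gtr0_real.
exists (complex.Re d) => [|z zad]; first by move: d0; rewrite dE ltcR.
rewrite /p eqxx; case: eqVneq => [_|za]; first by rewrite subrr cabs0.
have : `|0 - (z - a)| < d -> z - a != 0 ->
    `|'D_1 f a - (z - a)^-1 * (f ((z - a) * 1 + a) - f a)| < e%:C := h (z - a).
rewrite mulr1 subrK !cabsE dE !ltcR sub0r cabsN subr_eq0 cabsC mulrC.
by apply.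
Qed.

End ComplexDifferentiable.

(** * The maximum principle *)

Section MaximumPrinciple.
Variable R : realType.
Implicit Types (f : C R -> C R) (z a w : C R).

(** For [f w = 1 / (w - a)] this replaces the value [2 * pi * i] of the contour integral: the four
    sides contribute [Im f], [Re f], [- Im f] and [- Re f] to the imaginary part, all positive when
    [a] lies inside. *)
Lemma Im_sq_sum_ge f n z (s e : R) : 0 <= s ->
  (forall w, in_square z s w ->
    [/\ complex.Im w = complex.Im z -> e <= complex.Im (f w),
        complex.Re w = complex.Re z + s -> e <= complex.Re (f w),
        complex.Im w = complex.Im z + s -> e <= - complex.Im (f w) &
        complex.Re w = complex.Re z -> e <= - complex.Re (f w)]) ->
  4 * e <= complex.Im (sq_sum f n z s%:C).
Proof.
move=> s0 fe; rewrite /sq_sum.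
have le1 (t : R) : 0 <= t <= 1 -> 0 <= t * s <= s.
  by move=> /andP[t0 t1]; rewrite mulr_ge0 //= ler_piMl.
have h1 : e <= complex.Im (seg_avg f n z s%:C).
  apply: (seg_avg_convex (S := fun w => e <= complex.Im w)) => [a b ae be|t /le1 ts].
    by rewrite !ReImE Im_inv Re_inv cabs2 /=; lra.
  have [] := fe (z + t%:C * s%:C); first by rewrite /in_square /= !ReImE /=; lra.
  by move=> + _ _ _; apply; rewrite !ReImE /=; lra.
have h2 : e <= complex.Re (seg_avg f n (z + s%:C) ('i * s%:C)).
  apply: (seg_avg_convex (S := fun w => e <= complex.Re w)) => [a b ae be|t /le1 ts].
    by rewrite !ReImE Im_inv Re_inv cabs2 /=; lra.
  have [] := fe (z + s%:C + t%:C * ('i * s%:C)); first by rewrite /in_square /= !ReImE /=; lra.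
  by move=> _ + _ _; apply; rewrite !ReImE /=; lra.
have h3 : e <= - complex.Im (seg_avg f n (z + 'i * s%:C) s%:C).
  apply: (seg_avg_convex (S := fun w => e <= - complex.Im w)) => [a b ae be|t /le1 ts].
    by rewrite !ReImE Im_inv Re_inv cabs2 /=; lra.
  have [] := fe (z + 'i * s%:C + t%:C * s%:C); first by rewrite /in_square /= !ReImE /=; lra.
  by move=> _ _ + _; apply; rewrite !ReImE /=; lra.
have h4 : e <= - complex.Re (seg_avg f n z ('i * s%:C)).
  apply: (seg_avg_convex (S := fun w => e <= - complex.Re w)) => [a b ae be|t /le1 ts].
    by rewrite !ReImE Im_inv Re_inv cabs2 /=; lra.
  have [] := fe (z + t%:C * ('i * s%:C)); first by rewrite /in_square /= !ReImE /=; lra.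
  by move=> _ _ _ +; apply; rewrite !ReImE /=; lra.
by rewrite !ReImE /=; lra.
Qed.

(* Cauchy's theorem for [(f w - f a) ^ 2 / (w - a)], whose singularity at [a] is
   removable.  The constant [K] is harmless once the bound is applied to the
   powers of a function. *)
Lemma weak_maximum_principle z (s : R) a :
  complex.Re z < complex.Re a < complex.Re z + s ->
  complex.Im z < complex.Im a < complex.Im z + s ->
  exists K : R, forall f (M : R), (forall w, in_square z s w -> cdiff f w) ->
    (forall w, square_bd z s w -> cabs (f w) <= M) -> cabs (f a) <= K * M.
Proof.
move=> ar ai; have s0 : 0 < s by lra.
pose d := Num.min (Num.min (complex.Re a - complex.Re z) (complex.Im a - complex.Im z))
  (Num.min (complex.Re z + s - complex.Re a) (complex.Im z + s - complex.Im a)).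
have [d1 d2 d3 d4] : [/\ d <= complex.Re a - complex.Re z, d <= complex.Im a - complex.Im z,
    d <= complex.Re z + s - complex.Re a & d <= complex.Im z + s - complex.Im a].
  by split; rewrite /d !ge_min lexx ?orbT.
have d0 : 0 < d by rewrite /d !lt_min; lra.
have bd_ge w : square_bd z s w -> d <= cabs (w - a).
  have := cabs_Re (w - a); have := cabs_Re ('i * (w - a)).
  rewrite cabsM cabs_i mul1r !ReImE /= !ler_norml => h1 h2 [_ []] h; lra.
(* On each side one component of [w - a] is at least [d] in absolute value, and
   [|w - a| ^ 2 <= 2 * s ^ 2]. *)
pose e := d / (2 * s ^+ 2).
have e0 : 0 < e by rewrite divr_gt0 // mulr_gt0 // exprn_gt0.
(* If [|f a| > M], the final estimate reads [e * d * |f a| ^ 2 <= M ^ 2 + 2 * |f a| * M <= 3 * M *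
   |f a|]. *)
exists (1 + 3 / (e * d)) => f M fd fM.
set c := f a.
have M0 : 0 <= M.
  apply: le_trans (cabs_ge0 (f z)) (fM _ _); split; first by split; lra.
  by apply: Or41.
(* The square makes [h] differentiable at [a], where [h w = p w ^ 2 * (w - a)]; the factor [p] alone
   is only known to be continuous there. Since [0^-1 = 0], the quotient takes the right value at
   [a]. *)
pose h w := (f w - c) ^+ 2 / (w - a).
pose g w := (f w ^+ 2 - 2 * c * f w) / (w - a).
have hE : h = (fun w => g w + c ^+ 2 * (w - a)^-1).
  by apply/funext => w; rewrite /h /g; ring.
have hd w : in_square z s w -> cdiff h w.
  move=> zw; have fw := fd _ zw; have [->|wa] := eqVneq w a.
    have [p cp fp] : cdiff f a by apply: fd; split; lra.
    exists (fun w => p w ^+ 2).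
      by under eq_fun do rewrite expr2; exact: ccontM.
    move=> w'; rewrite /h /c (fp w') (subrr a) invr0 mulr0 subr0.
    have [->|wa] := eqVneq w' a; first by rewrite subrr invr0 !mulr0.
    by field; rewrite subr_eq0.
  apply: cdiffM; last first.
    by apply: cdiffV; [rewrite subr_eq0|apply: cdiffB; [exact: cdiff_id|exact: cdiff_cst]].
  by apply: cdiffX; apply: cdiffB => //; exact: cdiff_cst.
have gM w : square_bd z s w -> cabs (g w) <= (M ^+ 2 + 2 * cabs c * M) / d.
  move=> zw; rewrite /g cabsM cabsV; apply: ler_pM; rewrite ?cabs_ge0 ?invr_ge0 ?cabs_ge0 //.
    apply: le_trans (cabsB _ _) _; rewrite cabsX !cabsM cabs2.
    have fwM := fM _ zw; apply: lerD; first by rewrite lerXn2r // nnegrE ?cabs_ge0.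
    by rewrite ler_wpM2l // mulr_ge0 // cabs_ge0.
  have := bd_ge _ zw => dw; rewrite lef_pV2 ?posrE //; lra.
have key eps : 0 < eps ->
    4 * e * cabs c ^+ 2 <= eps * s + 4 * ((M ^+ 2 + 2 * cabs c * M) / d).
  move=> eps0; have [n /(_ n (leqnn _)) hn] := sq_sum_cvg0 (ltW s0) eps0 hd.
  have gn := sq_sum_le n (ltW s0) gM.
  have : cabs (c ^+ 2 * sq_sum (fun w => (w - a)^-1) n z s%:C) <=
      eps * s + 4 * ((M ^+ 2 + 2 * cabs c * M) / d).
    have -> : c ^+ 2 * sq_sum (fun w => (w - a)^-1) n z s%:C =
        sq_sum h n z s%:C - sq_sum g n z s%:C by rewrite hE sq_sum_lin; ring.
    by apply: le_trans (cabsB _ _) _; exact: lerD.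
  apply: le_trans; rewrite cabsM cabsX mulrC ler_wpM2l ?exprn_ge0 ?cabs_ge0 //.
  set S := sq_sum _ _ _ _.
  suff : 4 * e <= complex.Im S.
    move/le_trans; apply; apply: le_trans (ler_norm _) _.
    by have := cabs_Re ('i * S); rewrite cabsM cabs_i mul1r !ReImE /= mul0r mul1r sub0r normrN.
  apply: Im_sq_sum_ge => [|w [zr zi]]; first exact: ltW.
  have wa : square_bd z s w -> d <= cabs (w - a) by exact: bd_ge.
  have ge_e x : square_bd z s w -> d <= x -> e <= x / cabs (w - a) ^+ 2.
    move=> bw dx; have dw := wa bw.
    rewrite ler_pdivlMr ?exprn_gt0 //; last by lra.
    rewrite /e mulrAC ler_pdivrMr ?mulr_gt0 ?exprn_gt0 //.
    apply: ler_pM; [lra|exact: sqr_ge0|lra|].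
    by rewrite sqr_cabs !ReImE; nra.
  split=> E.
  - rewrite Im_inv; apply: ge_e; last by rewrite !ReImE; lra.
    by split=> //; apply: Or41.
  - rewrite Re_inv; apply: ge_e; last by rewrite !ReImE; lra.
    by split=> //; apply: Or42.
  - rewrite Im_inv -mulNr opprK; apply: ge_e; last by rewrite !ReImE; lra.
    by split=> //; apply: Or43.
  - rewrite Re_inv -mulNr; apply: ge_e; last by rewrite !ReImE; lra.
    by split=> //; apply: Or44.
have {}key : 4 * e * cabs c ^+ 2 <= 4 * ((M ^+ 2 + 2 * cabs c * M) / d).
  apply/ler_addgt0Pl => eps eps0; have := key (eps / s); rewrite divfK ?gt_eqF //.
  by apply; rewrite divr_gt0.
have c0 := cabs_ge0 c.
have ed0 : 0 < e * d by rewrite mulr_gt0.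
rewrite mulrDl mul1r; case: (leP (cabs c) M) => cM.
  by have : 0 <= 3 / (e * d) * M; [rewrite mulr_ge0 // divr_ge0 // ltW|lra].
have : e * d * cabs c ^+ 2 <= 3 * M * cabs c.
  move: key; rewrite mulrA ler_pdivlMr // => key.
  have : 4 * (e * d * cabs c ^+ 2) <= 4 * (M ^+ 2 + 2 * cabs c * M).
    by apply: le_trans key; rewrite le_eqVlt; apply/orP; left; apply/eqP; ring.
  have : M ^+ 2 <= M * cabs c by rewrite expr2 ler_wpM2l // ltW.
  lra.
rewrite expr2 mulrA ler_pM2r; last by lra.
rewrite mulrC -ler_pdivlMr // => h'.
have -> : 3 / (e * d) * M = 3 * M / (e * d) by rewrite mulrAC.
lra.
Qed.

End MaximumPrinciple.

(** * The Schwarz-Pick inequality *)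

Section SchwarzPick.
Variable R : realType.
Implicit Types (z a : C R).

Let H (z : C R) := 0 < complex.Re z.

Lemma ccontX (f : C R -> C R) n a : ccont f a -> ccont (fun z => f z ^+ n) a.
Proof.
move=> fa; elim: n => [|n IH]; first exact: ccont_cst.
by under eq_fun do rewrite exprS; exact: ccontM.
Qed.

(** With [X = z - zeta] this is the cancellation in [u ^+ n.+1 / b ^+ n]: one factor [X] survives,
    so Caratheodory's factor at [zeta] can be read off. *)
Lemma expr_quot (P X Q Y : C R) n : X != 0 ->
  (P * X / Q) ^+ n.+1 / (X / Y) ^+ n = (P / Q) ^+ n.+1 * Y ^+ n * X.
Proof.
move=> X0; have -> : P * X / Q = P / Q * X by ring.
rewrite exprMn [(X / Y) ^+ n]exprMn exprVn invfM invrK [X ^+ n.+1]exprSr.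
have : X ^+ n != 0 by rewrite expf_neq0.
move: (X ^+ n) (Y ^+ n) ((P / Q) ^+ n.+1) => x y p x0.
by field.
Qed.

(** By Bernoulli's inequality the powers of any [q > 1] are unbounded; this disposes of the constant
    in the maximum principle. *)
Lemma expr_bounded_le1 (x q K : R) : 0 < x -> 0 <= q ->
  (forall n, x * q ^+ n <= K) -> q <= 1.
Proof.
move=> x0 q0 xq; rewrite leNgt; apply/negP => q1.
have bern n : 1 + n%:R * (q - 1) <= q ^+ n.
  elim: n => [|n IH]; first by rewrite mul0r addr0.
  rewrite exprS -natr1.
  have : q * (1 + n%:R * (q - 1)) <= q * q ^+ n by rewrite ler_wpM2l.
  have : 0 <= n%:R * ((q - 1) * (q - 1)) :> R by rewrite mulr_ge0 // mulr_ge0; lra.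
  by lra.
have Kx : 0 <= K / x.
  rewrite divr_ge0 ?(ltW x0) //; apply: le_trans (xq 0%N).
  by rewrite expr0 mulr1 ltW.
have := archi_boundP (divr_ge0 Kx (_ : 0 <= q - 1)); set n := Num.Def.archi_bound _.
have q10 : 0 < q - 1 by lra.
move=> /(_ (ltW q10)); rewrite ltr_pdivrMr // => h.
have : x * q ^+ n <= x * (K / x) by rewrite mulrC [x * (_ / _)]mulrC divfK ?gt_eqF // mulrC.
by rewrite ler_pM2l //; have := bern n; lra.
Qed.

Lemma Re_neq0 z : 0 < complex.Re z -> z != 0.
Proof. by apply: contraTneq => ->; rewrite /= ltxx. Qed.

(** Divided by [|z + conj a| ^ 2], this computes how far the pseudo-hyperbolic distance of [z] and
    [a] stays below 1. *)
Lemma sqr_cabs_conj z a :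
  cabs (z + a^*%C) ^+ 2 = cabs (z - a) ^+ 2 + 4 * complex.Re z * complex.Re a.
Proof. by rewrite !sqr_cabs !ReImE; ring. Qed.

(* The maximum principle is applied to [u ^+ n.+1 / b ^+ n], where [u] and [b] are
   the Moebius images of [w] and of the identity that vanish at [zeta]: on the
   boundary of a large square [b] is nearly unimodular, and [n] tends to infinity. *)
Lemma schwarz_pick_pos (w : C R -> C R) (zeta a : C R) :
  (forall z, H z -> cdiff w z) -> (forall z, H z -> H (w z)) ->
  H zeta -> H a ->
  cabs (w a - w zeta) * cabs (a + zeta^*%C) <=
    cabs (a - zeta) * cabs (w a + (w zeta)^*%C).
Proof.
move=> wd wH zeta0 a0; have [->|aN] := eqVneq a zeta.
  by rewrite !subrr cabs0 !mul0r.
pose W := w zeta; have W0 : H W by exact: wH.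
have conj_neq0 z z' : H z -> H z' -> z + z'^*%C != 0.
  by move=> hz hz'; apply: Re_neq0; rewrite !ReImE; exact: addr_gt0.
pose u z := (w z - W) / (w z + W^*%C).
pose b z := (z - zeta) / (z + zeta^*%C).
have u1 z : H z -> cabs (u z) <= 1.
  move=> hz; have wz := wH _ hz; rewrite /u cabsM cabsV ler_pdivrMr ?mul1r; last first.
    by rewrite cabs_gt0 conj_neq0.
  rewrite -(ler_pXn2r (isT : (0 < 2)%N)) ?nnegrE ?cabs_ge0 // sqr_cabs_conj lerDl.
  by rewrite !mulr_ge0 // ltW.
suff ub : cabs (u a) <= cabs (b a).
  move: ub; rewrite /u /b !cabsM !cabsV ler_pdivrMr ?cabs_gt0 ?conj_neq0 //; last exact: wH.
  by rewrite mulrAC ler_pdivlMr // cabs_gt0 conj_neq0.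
have ba0 : 0 < cabs (b a).
  by rewrite cabs_gt0 /b mulf_neq0 ?subr_eq0 // invr_eq0 conj_neq0.
have [->|ua] := eqVneq (u a) 0; first by rewrite cabs0 cabs_ge0.
pose rho := complex.Re zeta; have rho0 : 0 < rho by [].
have key (e : R) : 0 < e -> e < 1 / 8 -> e * rho < complex.Re a ->
    complex.Re a * e < rho -> `|complex.Im a - complex.Im zeta| * e < rho ->
    cabs (u a) * (1 - 4 * e) <= cabs (b a).
  move=> e0 e8 ae1 ae2 ae3.
  pose t := rho / e; have tE : rho = t * e by rewrite /t divfK // gt_eqF.
  have t0 : 0 < t by rewrite divr_gt0.
  (* The square has its left side at distance [e * rho] from the imaginary axis, side [2 * rho / e],
     and is centred at the height of [zeta]. It exhausts the half-plane as [e] tends to 0, and the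
     conditions on [e] put [a] inside. *)
  pose z0 : C R := (e * rho) +i* (complex.Im zeta - t).
  have at1 : complex.Re a < t by rewrite /t ltr_pdivlMr.
  have at2 : `|complex.Im a - complex.Im zeta| < t by rewrite /t ltr_pdivlMr.
  have er0 : 0 < e * rho by rewrite mulr_gt0.
  move: at2; rewrite ltr_norml => at2; clearbody t.
  have [||K Kmax] := @weak_maximum_principle _ z0 (2 * t) a; rewrite /= ; [lra|lra|].
  have inH z : in_square z0 (2 * t) z -> H z.
    by rewrite /in_square /H /= => -[/andP[+ _] _]; lra.
  (* [1 - |b z| ^ 2 = 4 * Re z * rho / |z + conj zeta| ^ 2] is at most [4 * e]: on the left side
     [Re z = e * rho], and on the other sides [|z + conj zeta|] is at least both [Re z] and
     [t = rho / e]. *)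
  have b_ge z : square_bd z0 (2 * t) z -> 1 - 4 * e <= cabs (b z).
    move=> [zin zbd]; have Hz := inH _ zin.
    case: (leP 1 (cabs (b z))) => [|bz1]; first by lra.
    apply: (@le_trans _ _ (cabs (b z) ^+ 2)); last first.
      by rewrite expr2 ler_piMl ?cabs_ge0 // ltW.
    rewrite /b cabsM cabsV exprMn exprVn ler_pdivlMr; last first.
      by rewrite exprn_gt0 // cabs_gt0 conj_neq0.
    suff : complex.Re z * rho <= e * cabs (z + zeta^*%C) ^+ 2.
      by have := sqr_cabs_conj z zeta; rewrite -/rho; lra.
    rewrite sqr_cabs !ReImE -/rho.
    move: zin zbd; rewrite /in_square /=; move: Hz; rewrite /H.
    set x := complex.Re z; set y := complex.Im z; set y' := complex.Im zeta.
    move=> x0 [xr yr] zbd.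
    have sq0 : 0 <= e * (y - y') ^+ 2 by rewrite mulr_ge0 ?sqr_ge0 // ltW.
    
    have hor : (y - y') ^+ 2 = t ^+ 2 ->
        x * rho <= e * ((x + rho) ^+ 2 + (y - y') ^+ 2).
      move=> ->; have : 0 <= e * (x - t) ^+ 2 by rewrite mulr_ge0 ?sqr_ge0 // ltW.
      have : 0 <= e * (x * rho) by rewrite !mulr_ge0 // ltW.
      have : 0 <= e * rho ^+ 2 by rewrite mulr_ge0 ?sqr_ge0 // ltW.
      have : x * rho = x * t * e by rewrite [in LHS]tE mulrA.
      have : 0 <= x * t * e by rewrite !mulr_ge0 // ltW.
      lra.
    case: zbd => E; first by apply: hor; rewrite E; ring.
    - have : e * (2 * t * (x + rho)) <= e * ((x + rho) * (x + rho)).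
        by rewrite ler_pM2l // ler_pM2r //; lra.
      have : x * rho = x * t * e by rewrite [in LHS]tE mulrA.
      have : 0 <= e * (t * (x + rho)) by rewrite !mulr_ge0 // ?ltW //; lra.
      have : 0 <= e * (t * rho) by rewrite !mulr_ge0 // ltW.
      have : 0 <= e * (t * x) by rewrite !mulr_ge0 // ltW.
      by lra.
    - by apply: hor; rewrite E; ring.
    - rewrite E; have : 0 <= e * (rho * (e * rho)) by rewrite !mulr_ge0 // ltW.
      have : 0 <= e * (e * rho * (e * rho)) by rewrite !mulr_ge0 // ltW.
      by lra.
  have Fd n z : in_square z0 (2 * t) z -> cdiff (fun z => u z ^+ n.+1 / b z ^+ n) z.
    move=> /inH hz; have [->|zN] := eqVneq z zeta.
      have [p cp wp] := wd _ zeta0.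
      exists (fun z => (p z * (w z + W^*%C)^-1) ^+ n.+1 * (z + zeta^*%C) ^+ n).
        apply: ccontM.
          apply: ccontX; apply: ccontM => //.
          apply: (ccontV (f := fun z => w z + W^*%C)); first by rewrite conj_neq0.
          apply: ccontD; last exact: ccont_cst.
          exact/cdiff_ccont/wd.
        by apply: ccontX; apply: ccontD; [exact: ccont_id|exact: ccont_cst].
      move=> z'; have -> : u zeta = 0 by rewrite /u subrr mul0r.
      rewrite expr0n mul0r subr0 /u wp /b.
      have [->|zN] := eqVneq z' zeta; first by rewrite subrr mulr0 mul0r expr0n !mul0r mulr0.
      by rewrite expr_quot // subr_eq0.
    apply: cdiffM.
      apply: cdiffX; apply: cdiffM; first by apply: cdiffB; [exact: wd|exact: cdiff_cst].
      apply: (cdiffV (f := fun z => w z + W^*%C)); first by rewrite conj_neq0 //; exact: wH.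
      by apply: cdiffD; [exact: wd|exact: cdiff_cst].
    apply: (cdiffV (f := fun z => b z ^+ n)).
      by rewrite expf_neq0 // /b mulf_neq0 ?subr_eq0 // invr_eq0 conj_neq0.
    apply: cdiffX; apply: cdiffM; first by apply: cdiffB; [exact: cdiff_id|exact: cdiff_cst].
    apply: (cdiffV (f := fun z => z + zeta^*%C)); first by rewrite conj_neq0.
    by apply: cdiffD; [exact: cdiff_id|exact: cdiff_cst].
  have q0 : 0 < 1 - 4 * e by lra.
  suff : cabs (u a) * (1 - 4 * e) / cabs (b a) <= 1 by rewrite ler_pdivrMr // mul1r.
  (* [K] depends only on the square and on [a], so the same bound holds for every [n]. *)
  apply: (@expr_bounded_le1 (cabs (u a)) _ K) => [||n].
  - by rewrite cabs_gt0.
  - by rewrite !mulr_ge0 ?invr_ge0 ?cabs_ge0 // ltW.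
  have := Kmax _ ((1 - 4 * e) ^- n) (Fd n); rewrite cabsM cabsV !cabsX => h.
  have qn0 : 0 < (1 - 4 * e) ^+ n by rewrite exprn_gt0.
  have -> : cabs (u a) * (cabs (u a) * (1 - 4 * e) / cabs (b a)) ^+ n =
      cabs (u a) ^+ n.+1 / cabs (b a) ^+ n * (1 - 4 * e) ^+ n.
    by rewrite !exprMn exprVn exprS; ring.
  rewrite -ler_pdivlMr //; apply: h => z zbd.
  have Hz : H z by apply: inH; case: zbd.
  rewrite cabsM cabsV !cabsX.
  rewrite -[leRHS]mul1r; apply: ler_pM; rewrite ?invr_ge0 ?exprn_ge0 ?cabs_ge0 //.
    by rewrite exprn_ile1 ?cabs_ge0 ?u1.
  have bz := b_ge _ zbd.
  rewrite lef_pV2 ?posrE ?exprn_gt0 //; last exact: lt_le_trans bz.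
  by rewrite lerXn2r // nnegrE ?cabs_ge0 ?(ltW q0).
apply/ler_addgt0Pl => d d0.
(* The second term makes the loss [4 * e * |u a|] at most [d]; the others meet the conditions of
   [key], with room to spare for strict inequalities. *)
pose e := Num.min (1 / 16) (Num.min (d / (4 * (cabs (u a) + 1)))
  (Num.min (complex.Re a / (2 * rho)) (Num.min (rho / (2 * complex.Re a))
   (rho / (`|complex.Im a - complex.Im zeta| + 1))))).
have Ra0 : 0 < complex.Re a by [].
have y0 : 0 <= `|complex.Im a - complex.Im zeta| by [].
have ca0 := cabs_ge0 (u a).
have e0 : 0 < e.
  by rewrite /e !lt_min !divr_gt0 // ?mulr_gt0 //; lra.
have [e1 e2 e3 e4 e5] : [/\ e <= 1 / 16, e * (4 * (cabs (u a) + 1)) <= d,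
    e * (2 * rho) <= complex.Re a, e * (2 * complex.Re a) <= rho &
    e * (`|complex.Im a - complex.Im zeta| + 1) <= rho].
  split; rewrite -?ler_pdivlMr ?mulr_gt0 // /e ?ge_min ?lexx ?orbT //; lra.
have := key e e0; have er0 : 0 < e * rho by rewrite mulr_gt0.
have ea0 : 0 < e * complex.Re a by rewrite mulr_gt0.
move=> k; have {}k : cabs (u a) * (1 - 4 * e) <= cabs (b a) by apply: k; lra.
lra.
Qed.

(** Adding a small positive constant to [w] leaves its differences unchanged and makes the real part
    positive. The nonstrict form serves the increments [v s t - id], whose real part may vanish. *)
Lemma schwarz_pick (w : C R -> C R) (zeta a : C R) :
  (forall z, H z -> cdiff w z) -> (forall z, H z -> 0 <= complex.Re (w z)) ->
  H zeta -> H a ->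
  cabs (w a - w zeta) * cabs (a + zeta^*%C) <=
    cabs (a - zeta) * cabs (w a + (w zeta)^*%C).
Proof.
move=> wd wH zeta0 a0; apply/ler_addgt0Pr => d d0.
pose e := d / (2 * (cabs (a - zeta) + 1)).
have az0 := cabs_ge0 (a - zeta).
have e0 : 0 < e by rewrite divr_gt0 //; lra.
have := @schwarz_pick_pos (fun z => w z + e%:C) zeta a; rewrite /H.
have -> : w a + e%:C - (w zeta + e%:C) = w a - w zeta by ring.
have -> : w a + e%:C + (w zeta + e%:C)^*%C = w a + (w zeta)^*%C + (2 * e)%:C.
  case: (w a) (w zeta) => [x y] [x' y']; apply/eqP; rewrite eq_complex /=.
  by apply/andP; split; apply/eqP; ring.
move=> h; apply: le_trans (h _ _ zeta0 a0) _ => [z hz|z hz|].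
- by apply: cdiffD; [exact: wd|exact: cdiff_cst].
- by have := wH _ hz; rewrite !ReImE /=; lra.
apply: le_trans (ler_wpM2l az0 (cabsD _ _)) _.
rewrite cabs_real ger0_norm; last by lra.
have : e * (2 * (cabs (a - zeta) + 1)) = d by rewrite /e divfK // gt_eqF //; lra.
lra.
Qed.

End SchwarzPick.

(** * Densities of absolutely continuous functions *)

Section AbsolutelyContinuousDensity.
Variable R : realType.
Notation mu := (@lebesgue_measure R).

(** Any finite index type is allowed, so that families can be concatenated over [T + T'] and refined
    over a dependent sum without renumbering. *)
Definition disjoint_itvs (T : finType) (a b : R) (x y : T -> R) :=
  (forall i, [/\ a <= x i, x i <= y i & y i <= b]) /\
  (forall i j, i != j -> y i <= x j \/ y j <= x i).

Let le_mu (m : {measure set (measurableTypeR R) -> \bar R}) A B :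
  measurable A -> measurable B -> A `<=` B -> (m A <= m B)%E.
Proof. by move=> mA mB AB; apply: le_measure => //; rewrite inE. Qed.

Let itv_lt (x y z w e : R) :
  x < y <= z -> x < w <= z -> z - x < e -> `|y - w| < e.
Proof. by rewrite ltr_norml; lra. Qed.

Lemma lebesgue_stieltjes_measure_itv (V : cumulative R R) (x y : R) : x <= y ->
  lebesgue_stieltjes_measure V `]x, y]%classic = (V y - V x)%:E.
Proof.
move=> xy; rewrite /lebesgue_stieltjes_measure /measure_extension.
by rewrite measurable_mu_extE /=; [rewrite wlength_itv_bnd|exact: is_ocitv].
Qed.

Section Dyadic.
Variables (a b : R) (ab : a < b).

Let pt n k : R := a + k%:R * ((b - a) / 2 ^+ n).
Let cell n k : set R := `]pt n k, pt n k.+1].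
Let approx (U : set R) n : set R :=
  \big[setU/set0]_(k < 2 ^ n | `[< cell n k `<=` U >]) cell n k.

Let ptS n k : pt n k = pt n.+1 (k.*2).
Proof. by rewrite /pt -muln2 natrM exprS; field. Qed.

Let pt_le n k l : (k <= l)%N -> pt n k <= pt n l.
Proof.
move=> kl; rewrite lerD2l ler_wpM2r ?ler_nat //.
by rewrite divr_ge0 // subr_ge0 ltW.
Qed.

Let cell_half n k r : cell n k r -> exists2 l, (l < 2)%N & cell n.+1 (k.*2 + l)%N r.
Proof.
rewrite /cell /= !in_itv /= => /andP[r1 r2].
case: (leP r (pt n.+1 k.*2.+1)) => h.
  by exists 0%N => //; rewrite /cell addn0 /= in_itv /= -ptS r1.
by exists 1%N => //; rewrite /cell addn1 /= in_itv /= h -doubleS -ptS.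
Qed.

Let cellS n k l : (l < 2)%N -> cell n.+1 (k.*2 + l)%N `<=` cell n k.
Proof.
move=> l2 r; rewrite /cell /= !in_itv /= (ptS n k) (ptS n k.+1) => /andP[r1 r2]; apply/andP; split.
  by apply: le_lt_trans r1; apply: pt_le; rewrite leq_addr.
by apply: (le_trans r2); apply: pt_le; rewrite doubleS -addnS -addn2 leq_add2l.
Qed.

Let approxP U n r : approx U n r <->
  exists k, [/\ (k < 2 ^ n)%N, cell n k `<=` U & cell n k r].
Proof.
rewrite /approx big_mkcond -(bigcup_mkord (2 ^ n)
  (fun k => if `[< cell n k `<=` U >] then cell n k else set0)).
split=> [[k /= kn]|[k [kn kU kr]]].
  by case: asboolP => // kU kr; exists k.
by exists k => //; case: asboolP.
Qed.

Let approx_nd U : nondecreasing_seq (approx U).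
Proof.
apply/nondecreasing_seqP => n; apply/subsetPset => r /approxP[k [kn kU kr]].
have [l l2 lr] := cell_half kr; apply/approxP; exists (k.*2 + l)%N; split=> //.
  have : (k.*2 + 2 <= 2 ^ n.+1)%N by rewrite expnS mul2n addn2 -doubleS leq_double.
  by apply: leq_trans; rewrite ltn_add2l.
exact: subset_trans (cellS l2) kU.
Qed.

Let approx_cover U : open U -> U `&` `]a, b] `<=` \bigcup_n approx U n.
Proof.
move=> oU r [Ur]; rewrite /= in_itv /= => /andP[ar rb].
have cov n : exists2 k, (k < 2 ^ n)%N & cell n k r.
  elim: n => [|n [k kn kr]].
    by exists 0%N => //; rewrite /cell /pt /= in_itv /= expr0; lra.
  have [l l2 lr] := cell_half kr; exists (k.*2 + l)%N => //.
  have : (k.*2 + 2 <= 2 ^ n.+1)%N by rewrite expnS mul2n addn2 -doubleS leq_double.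
  by apply: leq_trans; rewrite ltn_add2l.
have [e /= e0 eU] := (nbhs_ballP _ _).1 (open_nbhs_nbhs (conj oU Ur)).
have [n hn] : exists n, (b - a) / 2 ^+ n < e.
  have ba : 0 < b - a by rewrite subr_gt0.
  have := archi_boundP (divr_ge0 (ltW ba) (ltW e0)).
  set m := Num.Def.archi_bound _ => hm; exists m.
  rewrite ltr_pdivrMr ?exprn_gt0 // mulrC -ltr_pdivrMr //.
  by apply: lt_trans hm _; rewrite -natrX ltr_nat; exact: ltn_expl.
have [k kn kr] := cov n; exists n => //; apply/approxP; exists k; split=> //.
move=> q kq; apply: eU.
move: kr kq; rewrite /cell /= !in_itv /= /pt -(natr1 k) /ball /=.
move: hn; set h := (b - a) / 2 ^+ n; move: (k%:R) => t.
by move=> he rk qk; apply: itv_lt rk qk _; rewrite (_ : _ - _ = h) //; ring.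
Qed.

Let cell_triv n : trivIset setT (fun k : nat => cell n k).
Proof.
apply: ltn_trivIset => m k mk; apply/seteqP; split=> // r [].
rewrite /cell /= !in_itv /= => /andP[_ r2] /andP[r1 _].
have := lt_le_trans r1 (le_trans r2 (pt_le n mk)).
by rewrite ltxx.
Qed.

Let measurable_approx U n : measurable (approx U n).
Proof. by apply: bigsetU_measurable => k _; exact: measurable_itv. Qed.

(* Half-open dyadic cells exhaust [U], so that absolute continuity has only to be
   used for finite families of intervals. *)
Lemma stieltjes_open_le (V : cumulative R R) (eps delta : R) (U : set R) :
  (forall (T : finType) (x y : T -> R), disjoint_itvs a b x y ->
    \sum_i (y i - x i) < delta -> \sum_i (V (y i) - V (x i)) <= eps) ->
  open U -> (mu (U `&` `]a, b]) < delta%:E)%E ->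
  (lebesgue_stieltjes_measure V (U `&` `]a, b]) <= eps%:E)%E.
Proof.
move=> AC oU muU; set nu := lebesgue_stieltjes_measure V.
have sub n : approx U n `<=` U `&` `]a, b].
  move=> r /approxP[k [kn kU kr]]; split; first exact: kU.
  move: kr; rewrite /cell /= !in_itv /= => /andP[r1 r2]; apply/andP; split.
    by apply: le_lt_trans r1; rewrite lerDl mulr_ge0 // divr_ge0 // subr_ge0 ltW.
  apply: (le_trans r2); apply: (le_trans (pt_le n kn)).
  by rewrite /pt natrX mulrC divfK ?expf_neq0 // addrC subrK.
have eqU : \bigcup_n approx U n = U `&` `]a, b].
  apply/seteqP; split; last exact: approx_cover.
  by apply: bigcup_sub => n _; exact: sub.
have mU : measurable (U `&` `]a, b]).
  by apply: measurableI => //; exact: open_measurable.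
have := @nondecreasing_cvg_mu _ _ _ nu (approx U) (measurable_approx U).
rewrite eqU => /(_ mU (@approx_nd U)) cvgU.
have limU := cvg_lim (@ereal_hausdorff R) cvgU.
apply: (@le_trans _ _ (lim ((lebesgue_stieltjes_measure V \o approx U) n @[n --> \oo]))).
  by rewrite limU.
apply: lime_le; first by apply/cvg_ex; eexists; exact: cvgU.
near=> n; rewrite /= {cvgU limU}.
have meas_approx (m : {measure set (measurableTypeR R) -> \bar R}) : m (approx U n) =
   (\sum_(k < 2 ^ n | `[< cell n k `<=` U >]) m (cell n k))%E.
  rewrite /approx measure_bigsetU_ord //; first by move=> k; exact: measurable_itv.
  have := @cell_triv n => /trivIsetP tr; apply/trivIsetP => i j _ _ ij.
  exact: tr.
pose x (k : 'I_(2 ^ n)) := pt n k.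
(* A cell not contained in [U] becomes a degenerate interval, which keeps the index set
   ['I_(2 ^ n)]. *)
pose y (k : 'I_(2 ^ n)) := if `[< cell n k `<=` U >] then pt n k.+1 else pt n k.
have xy k : x k <= y k by rewrite /x /y; case: ifP => // _; exact: pt_le.
have fam : disjoint_itvs a b x y.
  split=> [i|i j ij].
    split=> //; first by rewrite /x lerDl mulr_ge0 // divr_ge0 // subr_ge0 ltW.
    apply: (@le_trans _ _ (pt n i.+1)); first by rewrite /y; case: ifP => // _; exact: pt_le.
    apply: (le_trans (pt_le n (ltn_ord i))).
    by rewrite /pt natrX mulrC divfK ?expf_neq0 // addrC subrK.
  have yS k : y k <= pt n k.+1 by rewrite /y; case: ifP => // _; exact: pt_le.
  have [lt_ij|lt_ji|/val_inj eij] := ltngtP (val i) (val j).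
  - by left; apply: le_trans (yS i) _; exact: (pt_le n lt_ij).
  - by right; apply: le_trans (yS j) _; exact: (pt_le n lt_ji).
  - by rewrite eij eqxx in ij.
have sumE (f : R -> R) (m : {measure set (measurableTypeR R) -> \bar R}) :
    (forall u v, u <= v -> m `]u, v]%classic = (f v - f u)%:E) ->
    m (approx U n) = (\sum_k (f (y k) - f (x k)))%:E.
  move=> mf; rewrite meas_approx big_mkcond -sumEFin; apply: eq_bigr => k _.
  rewrite /x /y; case: ifP => _; last by rewrite subrr.
  by rewrite /cell mf //; exact: pt_le.
have le_len : (mu (approx U n) <= mu (U `&` `]a, b]))%E.
  by rewrite le_measure ?inE //; exact: measurable_approx.
have sumV := sumE V (lebesgue_stieltjes_measure V) (@lebesgue_stieltjes_measure_itv V).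
apply: (@le_trans _ _ (\sum_k (V (y k) - V (x k)))%:E); first by rewrite -sumV.
rewrite lee_fin; apply: AC => //.
rewrite -lte_fin; apply: le_lt_trans muU; apply: le_trans le_len.
rewrite (sumE id (@lebesgue_measure R)) // => u v uv.
have uvE : mu (`]u, v]%classic : set R) = (v - u)%:E.
  rewrite lebesgue_measure_itv /= lte_fin.
  by case: ltgtP uv => // -> _; rewrite subrr.
exact: uvE.
Unshelve. all: by end_near. Qed.

End Dyadic.

(** Restricted to []a, b]] the Stieltjes measure of [V] is finite. Outer regularity encloses a null
    set in an open set of length below [delta], whose Stieltjes measure is at most [eps] by
    [stieltjes_open_le]; this is the domination that Radon-Nikodym asks for. *)
Lemma cumulative_density (V : cumulative R R) (a b : R) : a < b ->
  (forall eps : R, 0 < eps -> exists2 delta : R, 0 < delta &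
    forall (T : finType) (x y : T -> R), disjoint_itvs a b x y ->
      \sum_i (y i - x i) < delta -> \sum_i (V (y i) - V (x i)) <= eps) ->
  exists f : R -> R, [/\ forall r, 0 <= f r, mu.-integrable setT (EFin \o f) &
    forall t u, a <= t -> t <= u -> u <= b ->
      V u - V t = \int[mu]_(r in `[t, u]) f r].
Proof.
move=> ab AC; pose nu0 := lebesgue_stieltjes_measure V.
have mab : measurable (`]a, b]%classic : set (measurableTypeR R)) by exact: measurable_itv.
have nuoo : (nu0 `]a, b]%classic < +oo)%E.
  by rewrite /nu0 lebesgue_stieltjes_measure_itv ?ltry // ltW.
pose nu : {finite_measure set (measurableTypeR R) -> \bar R} := mfrestr mab nuoo.
have nuE A : nu A = nu0 (A `&` `]a, b]%classic) by [].
have dom : nu `<< mu.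
  move=> N N0 A mA AN.
  have A0 : mu (A `&` `]a, b]%classic) = 0%E.
    by apply: N0; [exact: measurableI|exact: subset_trans AN].
  apply/eqP; rewrite eq_le measure_ge0 andbT nuE.
  apply/lee_addgt0Pr => eps eps0; rewrite add0e.
  have [delta delta0 ACd] := AC _ eps0.
  have mA' : measurable (A `&` `]a, b]%classic) by exact: measurableI.
  have Aoo : (mu (A `&` `]a, b]%classic) < +oo)%E by rewrite A0.
  have [U [oU AU mUA]] := lebesgue_regularity_outer mA' Aoo delta0.
  have mU : measurable U by exact: open_measurable.
  have Ud : (mu (U `&` `]a, b]%classic) < delta%:E)%E.
    have sub : U `&` `]a, b]%classic `<=`
        (A `&` `]a, b]%classic) `|` (U `\` (A `&` `]a, b]%classic)).
      by move=> r [Ur rab]; have [Ar|nAr] := pselect ((A `&` `]a, b]%classic) r); [left|right].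
    apply: (@le_lt_trans _ _ (mu (A `&` `]a, b]%classic) +
       mu (U `\` (A `&` `]a, b]%classic)))%E); last by rewrite A0 add0e.
    apply: (le_trans _ (measureU2 mu _ _)); [|exact: mA'|exact: measurableD].
    apply: le_mu sub; first exact: measurableI.
    by apply: measurableU => //; exact: measurableD.
  apply: le_trans (stieltjes_open_le ab ACd oU Ud).
  apply: le_mu => //; first exact: measurableI.
  by move=> r [Ar rab]; split=> //; exact: AU.
have [f [f0 ffin fint fE]] := radon_nikodym_sigma_finite dom.
exists (fine \o f); have fineE : EFin \o (fine \o f) = f.
  by apply/funext => r /=; rewrite fineK.
split=> [r||t u at_ tu ub]; [exact: fine_ge0|by rewrite fineE|].
apply: EFin_inj; rewrite -lebesgue_stieltjes_measure_itv //.
have -> : lebesgue_stieltjes_measure V `]t, u]%classic = nu `]t, u]%classic.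
  rewrite nuE setIidl // => r /=; rewrite !in_itv /= => /andP[tr ru].
  by rewrite (le_lt_trans at_ tr) (le_trans ru ub).
rewrite fE; last exact: measurable_itv.
have fint' : mu.-integrable `[t, u] f by exact: integrableS fint.
rewrite integral_itv_obnd_cbnd; last first.
  by apply: measurable_funS (measurable_int _ fint).
rewrite /Rintegral; have -> : (fun r => ((fine \o f) r)%:E) = f := fineE.
by rewrite fineK //; exact: integrable_fin_num.
Qed.

End AbsolutelyContinuousDensity.

(** * The variation function of an absolutely continuous function *)

Section Variation.
Variable R : realType.
Notation mu := (@lebesgue_measure R).

(** Taken half-open, the intervals are disjoint sets, so their total length is the measure of a
    union inside [[u, v]]. *)
Lemma disjoint_itvs_length (T : finType) (u v : R) (x y : T -> R) :
  u <= v -> disjoint_itvs u v x y -> \sum_i (y i - x i) <= v - u.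
Proof.
move=> uv [xy dis]; rewrite big_enum_val /=.
pose F (i : 'I_#|T|) : set (measurableTypeR R) := `[x (enum_val i), y (enum_val i)[%classic.
have mF i : measurable (F i) by exact: measurable_itv.
have tF : trivIset setT F.
  apply/trivIsetP => i j _ _ ij; apply/seteqP; split=> // r [].
  rewrite /F /= !in_itv /= => /andP[r1 r2] /andP[r3 r4].
  have /dis[h|h] : enum_val i != enum_val j by rewrite (inj_eq enum_val_inj).
    by have := lt_le_trans r2 (le_trans h r3); rewrite ltxx.
  by have := lt_le_trans r4 (le_trans h r1); rewrite ltxx.
have muF : (mu (\big[setU/set0]_(i < #|T|) F i) =
    \sum_(i < #|T|) (y (enum_val i) - x (enum_val i))%:E)%E.
  rewrite measure_bigsetU_ord //; apply: eq_bigr => i _.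
  have [_ xyi _] := xy (enum_val i).
  have : lebesgue_measure `[x (enum_val i), y (enum_val i)[%classic =
      (y (enum_val i) - x (enum_val i))%:E.
    rewrite lebesgue_measure_itv /= lte_fin; move: xyi.
    by case: ltgtP => // -> _; rewrite subrr.
  exact.
rewrite -lee_fin -sumEFin -muF.
have <- : lebesgue_measure `[u, v]%classic = (v - u)%:E.
  rewrite lebesgue_measure_itv /= lte_fin; move: uv.
  by case: ltgtP => // -> _; rewrite subrr.
apply: le_measure; rewrite ?inE; [|exact: measurable_itv|].
  by apply: bigsetU_measurable => i _; exact: mF.
rewrite big_seq; apply: (big_ind (fun A => A `<=` `[u, v]%classic)) => //.
  by move=> A B Auv Buv; rewrite subUset.
move=> i _ r; rewrite /F /= !in_itv /= => /andP[r1 r2].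
have [h1 _ h2] := xy (enum_val i).
by rewrite (le_trans h1 r1) (le_trans (ltW r2) h2).
Qed.

Section PseudoDistance.
Variable d : R -> R -> R.
Hypothesis d_ge0 : forall x y, 0 <= d x y.
Hypothesis d_refl : forall x, d x x = 0.
Hypothesis d_triangle : forall x y z, d x z <= d x y + d y z.

(** Disjoint families replace partitions: absolute continuity controls exactly these sums, and they
    are monotone in the interval with no gaps to fill. A function [G] will enter only through
    [d x y = |G y - G x|]. *)
Definition var_sums (u v : R) : set R :=
  [set s | exists (T : finType) (x y : T -> R),
    disjoint_itvs u v x y /\ s = \sum_i d (x i) (y i)].

Definition variation (u v : R) := sup (var_sums u v).

Lemma var_sums_mono u v u' v' : u' <= u -> v <= v' ->
  var_sums u v `<=` var_sums u' v'.
Proof.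
move=> uu' vv' _ [T [x [y [[xy dis] ->]]]]; exists T, x, y; split=> //; split=> // i.
by have [h1 h2 h3] := xy i; split=> //; [exact: le_trans h1|exact: le_trans h3 _].
Qed.

Lemma var_sums_single u v : u <= v -> var_sums u v (d u v).
Proof.
move=> uv; exists unit, (fun=> u), (fun=> v); split; last by rewrite big_const card_unit /= addr0.
by split=> [i|[] []]; rewrite ?lexx.
Qed.

Lemma var_sums_cat u m v s t :
  var_sums u m s -> var_sums m v t -> u <= m -> m <= v -> var_sums u v (s + t).
Proof.
move=> [T [x [y [[xy dis] ->]]]] [T' [x' [y' [[xy' dis'] ->]]]] um mv.
pose X (i : T + T') := match i with inl i => x i | inr i => x' i end.
pose Y (i : T + T') := match i with inl i => y i | inr i => y' i end.
exists (T + T')%type, X, Y; split; last by rewrite big_sumType.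
split=> [[i|i]|[i|i] [j|j] /= ij].
- by have [h1 h2 h3] := xy i; split=> //; exact: le_trans mv.
- by have [h1 h2 h3] := xy' i; split=> //; exact: le_trans h1.
- by apply: dis; apply: contraNneq ij => ->.
- left; have [_ _ h] := xy i; have [h' _ _] := xy' j; exact: le_trans h'.
- right; have [_ _ h] := xy j; have [h' _ _] := xy' i; exact: le_trans h'.
- by apply: dis'; apply: contraNneq ij => ->.
Qed.

(* Degenerate intervals are allowed, so a family is cut at [m] termwise. *)
Lemma var_sums_cut u m v s : u <= m -> m <= v -> var_sums u v s ->
  exists s1 s2, [/\ var_sums u m s1, var_sums m v s2 & s <= s1 + s2].
Proof.
move=> um mv [T [x [y [[xy dis] ->]]]].
exists (\sum_i d (Num.min (x i) m) (Num.min (y i) m)).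
exists (\sum_i d (Num.max (x i) m) (Num.max (y i) m)).
split.
- exists T, (fun i => Num.min (x i) m), (fun i => Num.min (y i) m).
  split=> //; split=> [i|i j /dis[] h].
  + have [h1 h2 h3] := xy i; split; first by rewrite le_min h1.
    * by rewrite le_min !ge_min h2 lexx !orbT.
    * by rewrite ge_min lexx orbT.
  + by left; rewrite le_min !ge_min h lexx !orbT.
  + by right; rewrite le_min !ge_min h lexx !orbT.
- exists T, (fun i => Num.max (x i) m), (fun i => Num.max (y i) m).
  split=> //; split=> [i|i j /dis[] h].
  + have [h1 h2 h3] := xy i; split; first by rewrite le_max lexx orbT.
    * by rewrite ge_max !le_max h2 lexx !orbT.
    * by rewrite ge_max h3.
  + by left; rewrite ge_max !le_max h lexx !orbT.
  + by right; rewrite ge_max !le_max h lexx !orbT.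
rewrite -big_split /=; apply: ler_sum => i _; have [_ xyi _] := xy i.
have [ym|ym] := orP (le_total (y i) m).
  by have xm := le_trans xyi ym; rewrite !min_l // !max_r // d_refl addr0.
have [xm|xm] := orP (le_total (x i) m).
  by rewrite (min_l xm) (min_r ym) (max_r xm) (max_l ym).
by rewrite (min_r xm) (min_r ym) (max_l xm) (max_l ym) d_refl add0r.
Qed.

Variables (a b : R).
Hypothesis ab : a < b.
Hypothesis dAC : forall eps : R, 0 < eps -> exists2 delta : R, 0 < delta &
    forall (T : finType) (x y : T -> R), disjoint_itvs a b x y ->
      \sum_i (y i - x i) < delta -> \sum_i d (x i) (y i) < eps.

(** On an interval of length at most [delta / 2] the sums are at most 1; finitely many such
    intervals cover [[a, b]], and [var_sums_cut] adds the bounds up. *)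
Lemma var_sums_bounded : exists B, forall s, var_sums a b s -> s <= B.
Proof.
have [delta delta0 h] := dAC ltr01; pose e := delta / 2.
have e0 : 0 < e by rewrite /e; lra.
have short u v s : a <= u -> u <= v -> v <= b -> v - u <= e -> var_sums u v s -> s <= 1.
  move=> au uv vb uve [T [x [y [xyd ->]]]]; apply/ltW/h.
    move: xyd => [xy dis]; split=> // i; have [h1 h2 h3] := xy i.
    by split=> //; [exact: le_trans h1|exact: le_trans vb].
  by apply: le_lt_trans (disjoint_itvs_length uv xyd) _; rewrite /e in uve; lra.
have steps (k : nat) v s : a <= v -> v <= b -> v <= a + k%:R * e ->
    var_sums a v s -> s <= k.+1%:R.
  elim: k v s => [|k IH] v s av vb vk vs.
    by apply: short vs => //; move: vk; rewrite mul0r addr0; lra.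
  case: (leP v (a + k%:R * e)) => vk'.
    by apply: le_trans (IH _ _ av vb vk' vs) _; rewrite ler_nat.
  have ak : a <= a + k%:R * e by rewrite lerDl mulr_ge0 // ltW.
  have [s1 [s2 [vs1 vs2 ss]]] := var_sums_cut ak (ltW vk') vs.
  apply: (le_trans ss); rewrite -natr1; apply: lerD.
    by apply: IH vs1 => //; lra.
  apply: short vs2 => //; [lra|].
  by move: vk; rewrite -natr1 mulrDl mul1r; lra.
have ba : 0 <= (b - a) / e by rewrite divr_ge0 ?subr_ge0 ?ltW.
exists (Num.Def.archi_bound ((b - a) / e)).+1%:R => s; apply: steps; rewrite ?(ltW ab) //.
by have := archi_boundP ba; rewrite ltr_pdivrMr //; lra.
Qed.

Let has_sup_var u v : a <= u -> u <= v -> v <= b -> has_sup (var_sums u v).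
Proof.
move=> au uv vb; split; first by exists (d u v); exact: var_sums_single.
have [B hB] := var_sums_bounded; exists B => s vs; apply: hB.
exact: var_sums_mono vs.
Qed.

Lemma variation_ge u v s : a <= u -> u <= v -> v <= b ->
  var_sums u v s -> s <= variation u v.
Proof. by move=> au uv vb; apply: sup_upper_bound; exact: has_sup_var. Qed.

Lemma variation_le u v c : u <= v ->
  (forall s, var_sums u v s -> s <= c) -> variation u v <= c.
Proof.
move=> uv h; apply: ge_sup; last by move=> s; exact: h.
by exists (d u v); exact: var_sums_single.
Qed.

Lemma variationD u m v : a <= u -> u <= m -> m <= v -> v <= b ->
  variation u v = variation u m + variation m v.
Proof.
move=> au um mv vb; have uv := le_trans um mv.
have am := le_trans au um; have mb := le_trans mv vb.
apply/eqP; rewrite eq_le; apply/andP; split.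
  apply: variation_le => // s /(var_sums_cut um mv)[s1 [s2 [vs1 vs2 ss]]].
  by apply: (le_trans ss); apply: lerD; exact: variation_ge.
rewrite -lerBrDr; apply: variation_le => // s1 vs1.
rewrite lerBrDr -lerBrDl; apply: variation_le => // s2 vs2.
by rewrite lerBrDl; apply: variation_ge => //; exact: var_sums_cat vs1 vs2 _ _.
Qed.

(** Each interval is filled with a family that nearly attains its variation. Merged over a dependent
    sum of index types, these families are disjoint and no longer in total than the given one, so
    absolute continuity applies to them. *)
Lemma variation_ac (eps : R) : 0 < eps -> exists2 delta : R, 0 < delta &
  forall (T : finType) (x y : T -> R), disjoint_itvs a b x y ->
    \sum_i (y i - x i) < delta -> \sum_i variation (x i) (y i) <= eps.
Proof.
move=> eps0; have [delta delta0 h] := dAC eps0.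
exists delta => // T x y [xy dis] len.
apply/ler_addgt0Pr => e e0.
(* The slack is shared out evenly; [+ 1] covers the empty family. *)
pose eta := e / (#|T|%:R + 1).
have T0 : 0 < #|T|%:R + 1 :> R by rewrite ltr_wpDl.
have eta0 : 0 < eta by rewrite divr_gt0.
have near_sup i : exists s, var_sums (x i) (y i) s /\ variation (x i) (y i) <= s + eta.
  have [h1 h2 h3] := xy i.
  have [s vs hs] := sup_adherent eta0 (has_sup_var h1 h2 h3).
  by exists s; split=> //; rewrite -/(variation _ _) in hs; lra.
have [s sP] := choice near_sup.
apply: (@le_trans _ _ (\sum_i (s i + eta))).
  by apply: ler_sum => i _; have [] := sP i.
rewrite big_split /= sumr_const; apply: lerD; last first.
  rewrite -mulr_natr /eta mulrAC ler_pdivrMr // ler_wpM2l //; first exact: ltW.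
  by rewrite lerDl.
have fams i : {T' : finType & {xy' : (T' -> R) * (T' -> R) |
    disjoint_itvs (x i) (y i) xy'.1 xy'.2 /\ s i = \sum_j d (xy'.1 j) (xy'.2 j)}}.
  have [+ _] := sP i => /cid[T' /cid[x' /cid[y' h']]].
  by exists T', (x', y').
pose T' i := projT1 (fams i).
pose x' i : T' i -> R := (sval (projT2 (fams i))).1.
pose y' i : T' i -> R := (sval (projT2 (fams i))).2.
have famP i : disjoint_itvs (x i) (y i) (x' i) (y' i) /\ s i = \sum_j d (x' i j) (y' i j).
  exact: (svalP (projT2 (fams i))).
pose S := {i : T & T' i}.
pose X (k : S) := x' (tag k) (tagged k); pose Y (k : S) := y' (tag k) (tagged k).
have sumS (F : forall i, T' i -> R) :
    \sum_(k : S) F (tag k) (tagged k) = \sum_i \sum_j F i j.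
  by rewrite (sig_big_dep (fun=> true) (fun _ => xpredT)).
have -> : \sum_i s i = \sum_(k : S) d (X k) (Y k).
  rewrite (sumS (fun i j => d (x' i j) (y' i j))).
  by apply: eq_bigr => i _; have [_ ->] := famP i.
apply/ltW/h.
  split=> [[i j]|[i j] [i' j'] ij].
    have [h1 h2 h3] := xy i; have [[/(_ j)[k1 k2 k3] _] _] := famP i.
    by split=> //=; [exact: le_trans k1|exact: le_trans h3].
  rewrite /X /Y /=; have [eii|/eqP nii] := pselect (i = i').
    move: j' ij; rewrite -eii => j' ij.
    have [[_ +] _] := famP i; apply; apply: contraNneq ij => ->.
    exact: eqxx.
  have [[/(_ j)[k1 k2 k3] _] _] := famP i; have [[/(_ j')[k1' k2' k3'] _] _] := famP i'.
  have [h'|h'] := dis _ _ nii.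
    by left; apply: le_trans k3 (le_trans h' k1').
  by right; apply: le_trans k3' (le_trans h' k1).
apply: le_lt_trans len; rewrite (sumS (fun i j => y' i j - x' i j)).
apply: ler_sum => i _; have [h1 h2 h3] := xy i; have [famd _] := famP i.
exact: disjoint_itvs_length famd.
Qed.

(** A [cumulative] function lives on the whole line; clipping the argument to [[a, b]] makes the
    variation function [V] constant outside. *)
Let clip (t : R) := Num.max a (Num.min t b).

Let clip_id t : a <= t -> t <= b -> clip t = t.
Proof. by move=> at_ tb; rewrite /clip min_l // max_r. Qed.

Let clip_itv t : a <= clip t <= b.
Proof. by rewrite /clip le_max lexx /= ge_max ge_min lexx orbT (ltW ab). Qed.

Let clip_le s t : s <= t -> clip s <= clip t.
Proof.
move=> st; rewrite /clip; have ab' := ab; case: (leP t b) => ?;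
  case: (leP s b) => ?; case: (leP a s) => ?; case: (leP a t) => ?; case: (leP a b) => ?; lra.
Qed.

Let clip_lip s t : s <= t -> clip t - clip s <= t - s.
Proof.
move=> st; rewrite /clip; have ab' := ab; case: (leP t b) => ?;
  case: (leP s b) => ?; case: (leP a s) => ?; case: (leP a t) => ?; case: (leP a b) => ?; lra.
Qed.

Let V t := variation a (clip t).

Let VB s t : s <= t -> V t - V s = variation (clip s) (clip t).
Proof.
move=> st; have /andP[h1 _] := clip_itv s; have /andP[_ h2] := clip_itv t.
by rewrite /V (@variationD a (clip s)) ?clip_le // addrC addKr.
Qed.

Let variation_ge0 u v : a <= u -> u <= v -> v <= b -> 0 <= variation u v.
Proof.
move=> au uv vb; apply: (le_trans (d_ge0 u v)); apply: variation_ge => //.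
exact: var_sums_single.
Qed.

Let V_nd : {homo V : s t / s <= t}.
Proof.
move=> s t st; rewrite -subr_ge0 VB //.
have /andP[h1 _] := clip_itv s; have /andP[_ h2] := clip_itv t.
by apply: variation_ge0 => //; exact: clip_le.
Qed.

Let V_rc : right_continuous V.
Proof.
move=> s; apply/cvgrPdist_le => e e0.
have [delta delta0 h] := variation_ac e0.
near=> t; have st : s <= t by [].
rewrite distrC ger0_norm ?subr_ge0 ?V_nd // VB //.
have /andP[h1 _] := clip_itv s; have /andP[_ h2] := clip_itv t.
have := h unit (fun=> clip s) (fun=> clip t).
rewrite !big_const !card_unit /= !addr0; apply.
  by split=> [i|[] []]; rewrite ?eqxx //; split=> //; exact: clip_le.
apply: le_lt_trans (clip_lip st) _; rewrite ltrBlDl.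
near: t; apply: nbhs_right_lt; rewrite ltrDl //.
Unshelve. all: by end_near. Qed.

Theorem ac_density : exists f : R -> R,
  [/\ forall r, 0 <= f r, mu.-integrable setT (EFin \o f) &
    forall t u, a <= t -> t <= u -> u <= b ->
      d t u <= \int[mu]_(r in `[t, u]) f r].
Proof.
pose W : cumulative R R := HB.pack V (isCumulative.Build R _ R V V_nd V_rc).
have [|f [f0 fint fE]] := @cumulative_density R W a b ab.
  move=> eps eps0; have [delta delta0 h] := variation_ac eps0.
  exists delta => // T x y xyd len; apply: le_trans (h T x y xyd len).
  rewrite le_eqVlt; apply/orP; left; apply/eqP; apply: eq_bigr => i _.
  have [h1 h2 h3] := xyd.1 i.
  have -> : W (y i) - W (x i) = V (y i) - V (x i) by [].
  by rewrite VB // !clip_id // ?(le_trans h1 h2) ?(le_trans h2 h3).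
exists f; split=> // t u at_ tu ub; rewrite -fE //.
have -> : W u - W t = V u - V t by [].
rewrite VB // !clip_id // ?(le_trans tu ub) ?(le_trans at_ tu) //.
by apply: variation_ge => //; exact: var_sums_single.
Qed.

End PseudoDistance.
End Variation.

(** * Self-maps of the right half-plane *)

Section HalfPlaneFamilies.
Variable R : realType.
Implicit Types (z a c xi : C R).

Let H (z : C R) := 0 < complex.Re z.

(** With [X = |a + conj c|] and [Y = |a - c|], Schwarz-Pick and the triangle inequality give
    [|P a| * (X - Y) <= |P c| * (X + Y)]. Multiplying by [X + Y] produces
    [X ^ 2 - Y ^ 2 = 4 * Re a * Re c], and [X + Y <= 2 * (|a| + |c|)]. *)
Lemma harnack (P : C R -> C R) a c :
  (forall z, H z -> cdiff P z) -> (forall z, H z -> 0 <= complex.Re (P z)) ->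
  H a -> H c ->
  cabs (P a) * (complex.Re a * complex.Re c) <= (cabs a + cabs c) ^+ 2 * cabs (P c).
Proof.
move=> Pd P0 Ha Hc; have := schwarz_pick Pd P0 Hc Ha.
have := sqr_cabs_conj a c.
have : cabs (a + c^*%C) <= cabs a + cabs c.
  by apply: le_trans (cabsD _ _) _; rewrite cabs_conj.
have : cabs (a - c) <= cabs a + cabs c by exact: cabsB.
have : cabs (P a) - cabs (P c) <= cabs (P a - P c).
  by rewrite lerBlDr; apply: le_trans (cabsD _ _); rewrite subrK.
have : cabs (P a + (P c)^*%C) <= cabs (P a) + cabs (P c).
  by apply: le_trans (cabsD _ _) _; rewrite cabs_conj.
move: (cabs_ge0 (a - c)) (cabs_ge0 (a + c^*%C)) (cabs_ge0 (P a)) (cabs_ge0 (P c)).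
move: (cabs (P a - P c)) (cabs (P a + _)) (cabs (P a)) (cabs (P c)) => D S p q.
move: (cabs (a - c)) (cabs (a + c^*%C)) (cabs a + cabs c) => Y X L.
move: (complex.Re a) (complex.Re c) => x y Y0 X0 p0 q0 SL Dpq YL XL XY sp.
have h1 : (p - q) * X <= Y * (p + q).
  apply: (@le_trans _ _ (D * X)); first by rewrite ler_wpM2r.
  by apply: (le_trans sp); rewrite ler_wpM2l.
have h2 : p * (X - Y) <= q * (X + Y) by lra.
have h3 : p * (X - Y) * (X + Y) <= q * (X + Y) * (X + Y).
  by rewrite ler_wpM2r // addr_ge0.
have h4 : (X + Y) * (X + Y) <= (L + L) * (L + L).
  by apply: ler_pM; rewrite ?addr_ge0 // lerD.
have h5 : q * ((X + Y) * (X + Y)) <= q * ((L + L) * (L + L)) by rewrite ler_wpM2l.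
have h6 : p * (X - Y) * (X + Y) = p * (4 * x * y).
  have -> : 4 * x * y = X ^+ 2 - Y ^+ 2 by rewrite XY; ring.
  by ring.
rewrite h6 in h3; lra.
Qed.

(** Schwarz-Pick is applied to [z] and a large real [x], which tends to infinity. The quotient
    [x / w x] is the form in which the charts at finite boundary points deliver the angular
    derivative. *)
Lemma julia (w : C R -> C R) (l : C R) :
  (forall z, H z -> cdiff w z) -> (forall z, H z -> H (w z)) ->
  complex.Re l <= 1 ->
  (forall e : R, 0 < e -> exists2 X : R, 0 < X & forall x : R, X < x ->
     cabs (x%:C / w x%:C - l) < e) ->
  forall z, H z -> complex.Re z <= complex.Re (w z).
Proof.
move=> wd wH l1 lim z Hz; have Hw := wH _ Hz.
set W := w z.
pose K := 1 + cabs l; have K0 : 1 <= K by rewrite lerDl cabs_ge0.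
apply/ler_addgt0Pr => e e0.
(* The inequality with relative error [t] at a fixed [x], so large that [|z| <= t * x] and
   [|W| <= t * |w x|]. *)
have main (x t : R) : 0 < x -> 0 < t ->  t < 1 -> cabs (x%:C / w x%:C - l) < t ->
    cabs W * K <= t * x -> cabs z <= t * x ->
    complex.Re z * (1 - t) ^+ 2 <= complex.Re W * (1 + t) * (1 + t) ^+ 2.
  move=> x0 t0 t1 rt Wx zx.
  have Hx : H x%:C by [].
  have Hwx := wH _ Hx; set r := x%:C / w x%:C.
  have wx0 : w x%:C != 0 by apply: Re_neq0.
  have cx0 : x%:C != 0 :> C R by apply: Re_neq0.
  have rK : cabs r <= K.
    have -> : r = (r - l) + l by ring.
    by apply: le_trans (cabsD _ _) _; rewrite /K -/r in rt *; lra.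
  have Rer : complex.Re r <= 1 + t.
    have -> : r = (r - l) + l by ring.
    by rewrite Re_add; have := Re_cabs (r - l); rewrite -/r in rt; lra.
  have sp := schwarz_pick wd (fun z hz => ltW (wH z hz)) Hx Hz.
  rewrite -/W in sp.
  (* Schwarz-Pick squared, with [|z + x|^2 = |z - x|^2 + 4 x Re z]; then divide by
     [x^2 |w x|^2] *)
  have sq : complex.Re z * x * cabs (W + (w x%:C)^*%C) ^+ 2 <=
      complex.Re W * complex.Re (w x%:C) * cabs (z + x%:C^*%C) ^+ 2.
    have e1 := sqr_cabs_conj W (w x%:C); have e2 := sqr_cabs_conj z x%:C.
    have : (cabs (W - w x%:C) * cabs (z + x%:C^*%C)) ^+ 2 <=
        (cabs (z - x%:C) * cabs (W + (w x%:C)^*%C)) ^+ 2.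
      by rewrite lerXn2r // nnegrE mulr_ge0 // cabs_ge0.
    rewrite !exprMn /= in e2 *.
    move: e1 e2; set A := cabs (W - _) ^+ 2; set B := cabs (W + _) ^+ 2.
    set A' := cabs (z - _) ^+ 2; set B' := cabs (z + _) ^+ 2 => e1 e2.
    have -> : A = B - 4 * complex.Re W * complex.Re (w x%:C) by rewrite e1; ring.
    have -> : A' = B' - 4 * complex.Re z * x by rewrite e2; ring.
    lra.
  have q1 : cabs (W + (w x%:C)^*%C) ^+ 2 >= (1 - t) ^+ 2 * cabs (w x%:C) ^+ 2.
    rewrite -exprMn lerXn2r ?nnegrE ?mulr_ge0 ?cabs_ge0 //; first by lra.
    have : cabs (w x%:C) <= cabs (W + (w x%:C)^*%C) + cabs W.
      rewrite -(cabs_conj (w x%:C)) -(cabsN W).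
      by apply: le_trans (cabsD _ _); rewrite addrC addKr.
    have : cabs W <= t * cabs (w x%:C).
      have : x = cabs r * cabs (w x%:C).
        by rewrite -cabsM /r divfK // cabs_real gtr0_norm.
      move=> xE; have : x <= K * cabs (w x%:C) by rewrite {1}xE ler_wpM2r ?cabs_ge0.
      move=> h; have h' : t * x <= t * (K * cabs (w x%:C)) by rewrite ler_wpM2l // ltW.
      rewrite -(ler_pM2r (lt_le_trans ltr01 K0)); lra.
    lra.
  have q2 : cabs (z + x%:C^*%C) ^+ 2 <= (1 + t) ^+ 2 * x ^+ 2.
    rewrite -exprMn lerXn2r ?nnegrE ?mulr_ge0 ?cabs_ge0 //; [lra|exact: ltW|].
    apply: le_trans (cabsD _ _) _; rewrite cabs_conj cabs_real gtr0_norm //; lra.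
  have q3 : complex.Re (w x%:C) * x = complex.Re r * cabs (w x%:C) ^+ 2.
    rewrite /r Re_mul Re_inv Im_inv /= mul0r subr0.
    by rewrite -mulrA divfK 1?mulrC // expf_neq0 // cabs_eq0.
  have wx2 : 0 < cabs (w x%:C) ^+ 2 by rewrite exprn_gt0 // cabs_gt0.
  have x2 : 0 < x ^+ 2 by rewrite exprn_gt0.
  rewrite -(ler_pM2r wx2) -(ler_pM2r x2).
  have s1 : complex.Re z * x * ((1 - t) ^+ 2 * cabs (w x%:C) ^+ 2) <=
      complex.Re z * x * cabs (W + (w x%:C)^*%C) ^+ 2.
    by rewrite ler_wpM2l // mulr_ge0 // ltW.
  have s2 : complex.Re W * complex.Re (w x%:C) * cabs (z + x%:C^*%C) ^+ 2 <=
      complex.Re W * complex.Re (w x%:C) * ((1 + t) ^+ 2 * x ^+ 2).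
    by rewrite ler_wpM2l // mulr_ge0 // ltW.
  have s3 := ler_wpM2r (ltW x0) (le_trans s1 (le_trans sq s2)).
  have s4 : complex.Re W * (1 + t) ^+ 2 * x ^+ 2 * (complex.Re r * cabs (w x%:C) ^+ 2) <=
     complex.Re W * (1 + t) ^+ 2 * x ^+ 2 * ((1 + t) * cabs (w x%:C) ^+ 2).
    apply: ler_wpM2l; last by apply: ler_wpM2r => //; exact: ltW.
    by rewrite mulr_ge0 ?sqr_ge0 // mulr_ge0 ?sqr_ge0 // ltW.
  rewrite -q3 in s4; lra.
(* Expanded for [t <= 1], [main] yields [Re z - Re W <= t * (2 * Re z + 7 * Re W)], which this [t]
   makes at most [e]. *)
pose t := Num.min (1 / 2) (e / (2 * complex.Re z + 4 * complex.Re W * 4 + 1)).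
have Rz0 : 0 < complex.Re z by []. 
have RW0 : 0 < complex.Re W by [].
have t0 : 0 < t by rewrite lt_min !divr_gt0 //; lra.
have [t1 t2] : t <= 1 / 2 /\ t * (2 * complex.Re z + 4 * complex.Re W * 4 + 1) <= e.
  split; first by rewrite /t ge_min lexx.
  by rewrite -ler_pdivlMr; [rewrite /t ge_min lexx orbT|lra].
have [X X0 hX] := lim _ t0.
pose x := 1 + X + cabs W * K / t + cabs z / t.
have [h1 h2] : 0 <= cabs W * K / t /\ 0 <= cabs z / t.
  by split; rewrite !mulr_ge0 ?invr_ge0 ?cabs_ge0 ?(ltW t0) //; lra.
have tx : t * x = t + t * X + cabs W * K + cabs z.
  by rewrite /x; field; rewrite gt_eqF.
have tX : 0 < t * X by rewrite mulr_gt0.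
have WK0 : 0 <= cabs W * K by rewrite mulr_ge0 ?cabs_ge0 //; lra.
have := main x t; rewrite {1 2}/x tx.
have cz0 := cabs_ge0 z.
move=> /(_ _ t0 _ (hX _ _)) h.
have {}h : complex.Re z * (1 - t) ^+ 2 <= complex.Re W * (1 + t) * (1 + t) ^+ 2.
  by apply: h; rewrite /x; lra.
have tz : 0 < t * complex.Re z by rewrite mulr_gt0.
have tW : 0 < t * complex.Re W by rewrite mulr_gt0.
have ttz : 0 < t * (t * complex.Re z) by rewrite mulr_gt0.
have ttW : t * (t * complex.Re W) <= t * complex.Re W by rewrite ger_pMl //; lra.
have tttW : t * (t * (t * complex.Re W)) <= t * (t * complex.Re W).
  by rewrite ger_pMl ?mulr_gt0 //; lra.
lra.
Qed.

End HalfPlaneFamilies.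

(** * Families on the half-plane over a compact time interval *)

Section HalfPlaneCore.
Variable R : realType.
Implicit Types (z a c xi : C R).

Let H (z : C R) := 0 < complex.Re z.

Variables (T : R) (v : R -> R -> C R -> C R) (c : C R).
Hypothesis vd : forall s t, 0 <= s -> s <= t -> t <= T -> forall z, H z -> cdiff (v s t) z.
Hypothesis vRe : forall s t, 0 <= s -> s <= t -> t <= T ->
  forall z, H z -> complex.Re z <= complex.Re (v s t z).
Hypothesis v_id : forall s, 0 <= s -> s <= T -> forall z, H z -> v s s z = z.
Hypothesis v_comp : forall s t u, 0 <= s -> s <= t -> t <= u -> u <= T ->
  forall z, H z -> v s u z = v s t (v t u z).
Hypothesis v_near : forall e : R, 0 < e -> exists2 delta : R, 0 < delta &
  forall s t, 0 <= s -> s <= t -> t <= T -> t - s <= delta -> cabs (v s t c - c) <= e.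
Hypothesis Hc : H c.

Let vH s t : 0 <= s -> s <= t -> t <= T -> forall z, H z -> H (v s t z).
Proof. by move=> s0 st tT z Hz; apply: lt_le_trans Hz (vRe _ _ _ Hz). Qed.

Let incr_le s t a : 0 <= s -> s <= t -> t <= T -> H a ->
  cabs (v s t a - a) * (complex.Re a * complex.Re c) <=
    (cabs a + cabs c) ^+ 2 * cabs (v s t c - c).
Proof.
move=> s0 st tT Ha; apply: (harnack (P := fun z => v s t z - z)) => // z Hz.
  by apply: cdiffB; [exact: vd|exact: cdiff_id].
by rewrite !ReImE subr_ge0 vRe.
Qed.

(** The outermost map [v s m] covers a time of at most [delta] and moves the point [v m t xi],
    bounded by induction, by an amount that Harnack controls. Monotonicity of the real part keeps
    the Harnack constant from degenerating. *)
Lemma half_plane_bounded xi : H xi -> exists2 M : R, 0 <= M &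
  forall s t, 0 <= s -> s <= t -> t <= T -> cabs (v s t xi) <= M.
Proof.
move=> Hxi; have [delta delta0 hd] := v_near ltr01.
have Rxi : 0 < complex.Re xi by [].
have Rc : 0 < complex.Re c by [].
have steps (k : nat) : exists2 M : R, 0 <= M &
    forall s t, 0 <= s -> s <= t -> t <= T -> t - s <= k%:R * delta -> cabs (v s t xi) <= M.
  elim: k => [|k [M M0 IH]].
    exists (cabs xi) => [|s t s0 st tT]; first exact: cabs_ge0.
    rewrite mul0r subr_le0 => ts; have -> : t = s by apply/eqP; rewrite eq_le ts.
    by rewrite v_id // (le_trans st).
  exists (M + (M + cabs c) ^+ 2 / (complex.Re xi * complex.Re c)) => [|s t s0 st tT].
    by rewrite addr_ge0 // divr_ge0 ?sqr_ge0 // mulr_ge0 // ltW.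
  rewrite -natr1 mulrDl mul1r => tsk.
  pose m := Num.min t (s + delta).
  have [sm mt md] : [/\ s <= m, m <= t & m - s <= delta].
    rewrite /m; split; [rewrite le_min st /=; lra|by rewrite ge_min lexx|].
    by rewrite lerBlDl ge_min lexx orbT.
  have mk : t - m <= k%:R * delta.
    rewrite lerBlDl -lerBlDr le_min; have : 0 <= k%:R * delta by rewrite mulr_ge0 // ltW.
    by lra.
  have m0 := le_trans s0 sm; have mT := le_trans mt tT.
  set a := v m t xi; have aM : cabs a <= M by exact: IH.
  have Ha : H a by exact: vH.
  have Ra : complex.Re xi <= complex.Re a by exact: vRe.
  rewrite (v_comp s0 sm mt tT Hxi) -/a.
  have -> : v s m a = a + (v s m a - a) by ring.
  apply: le_trans (cabsD _ _) _; apply: lerD => //.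
  rewrite ler_pdivlMr ?mulr_gt0 //.
  apply: (@le_trans _ _ (cabs (v s m a - a) * (complex.Re a * complex.Re c))).
    by rewrite ler_wpM2l ?cabs_ge0 // ler_wpM2r // ltW.
  apply: le_trans (incr_le s0 sm mT Ha) _.
  rewrite -[leRHS]mulr1; apply: ler_pM; rewrite ?sqr_ge0 ?cabs_ge0 //; last exact: hd.
  by rewrite lerXn2r ?nnegrE ?addr_ge0 ?cabs_ge0 // lerD2r.
have [M M0 hM] := steps (Num.Def.archi_bound (`|T| / delta)).
exists M => // s t s0 st tT; apply: hM => //.
have := archi_boundP (divr_ge0 (normr_ge0 T) (ltW delta0)).
by rewrite ltr_pdivrMr //; have := ler_norm T; lra.
Qed.

(** At [a = v s' u c] and [b = v s' t c] the increment [v s s' - id] has modulus at most [Re c / 2],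
    while [|a + conj b| >= 2 * Re c]. Schwarz-Pick then bounds the difference of its two values by
    [|a - b| / 2]. *)
Let expansion : exists2 delta : R, 0 < delta &
  forall s s' t u, 0 <= s -> s <= s' -> s' <= t -> t <= u -> u <= T -> s' - s <= delta ->
    cabs (v s' u c - v s' t c) <= 2 * cabs (v s u c - v s t c).
Proof.
have [M M0 hM] := half_plane_bounded Hc.
have Rc : 0 < complex.Re c by [].
have cc := cabs_ge0 c; have c1 : 0 < M + cabs c.
  by have := Re_cabs c; lra.
(* Chosen so that Harnack's bound [(M + |c|) ^ 2 * e / Re c ^ 2] equals [Re c / 2]. *)
pose e := complex.Re c ^+ 3 / (2 * (M + cabs c) ^+ 2).
have e0 : 0 < e by rewrite divr_gt0 ?mulr_gt0 ?exprn_gt0.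
have [delta delta0 hd] := v_near e0.
exists delta => // s s' t u s0 ss' s't tu uT ss'd.
have s'0 := le_trans s0 ss'; have tT := le_trans tu uT; have s't' := le_trans s't tu.
have s'T := le_trans s't tT; have t0 := le_trans s'0 s't.
set a := v s' u c; set b := v s' t c.
have ua : v s u c = v s s' a by exact: v_comp.
have tb : v s t c = v s s' b by exact: v_comp.
rewrite ua tb.
have small x : H x -> complex.Re c <= complex.Re x -> cabs x <= M ->
    cabs (v s s' x - x) <= complex.Re c / 2.
  move=> Hx cx xM; have Rc2 : 0 < complex.Re c * complex.Re c by rewrite mulr_gt0.
  rewrite -(ler_pM2r Rc2).
  apply: (@le_trans _ _ (cabs (v s s' x - x) * (complex.Re x * complex.Re c))).
    by rewrite ler_wpM2l ?cabs_ge0 // ler_wpM2r // ltW.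
  apply: le_trans (incr_le s0 ss' s'T Hx) _.
  apply: (@le_trans _ _ ((M + cabs c) ^+ 2 * e)).
    apply: ler_pM; rewrite ?sqr_ge0 ?cabs_ge0 //; last exact: hd.
    by rewrite lerXn2r ?nnegrE ?addr_ge0 ?cabs_ge0 // lerD2r.
  rewrite /e le_eqVlt; apply/orP; left; apply/eqP; field.
  by rewrite gt_eqF.
have Ha : H a by exact: vH.
have Hb : H b by exact: vH.
have ca : complex.Re c <= complex.Re a by exact: vRe.
have cb : complex.Re c <= complex.Re b by exact: vRe.
have pa := small _ Ha ca (hM _ _ s'0 s't' uT).
have pb := small _ Hb cb (hM _ _ s'0 s't tT).
have sp : cabs (v s s' a - a - (v s s' b - b)) * cabs (a + b^*%C) <=
    cabs (a - b) * cabs (v s s' a - a + (v s s' b - b)^*%C).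
  apply: (schwarz_pick (w := fun z => v s s' z - z)) => // z Hz.
    by apply: cdiffB; [exact: vd|exact: cdiff_id].
  by rewrite !ReImE subr_ge0 vRe.
have X2 : 2 * complex.Re c <= cabs (a + b^*%C).
  by apply: le_trans (Re_cabs _); rewrite !ReImE; lra.
have S2 : cabs (v s s' a - a + (v s s' b - b)^*%C) <= complex.Re c.
  by apply: le_trans (cabsD _ _) _; rewrite cabs_conj; lra.
have ab0 := cabs_ge0 (a - b).
have half : cabs (v s s' a - a - (v s s' b - b)) * (2 * complex.Re c) <=
    cabs (a - b) * complex.Re c.
  apply: le_trans (le_trans sp _); first by rewrite ler_wpM2l ?cabs_ge0.
  by rewrite ler_wpM2l.
rewrite mulrA ler_pM2r // in half.
have : cabs (a - b) <= cabs (v s s' a - v s s' b) + cabs (v s s' a - a - (v s s' b - b)).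
  have -> : a - b = (v s s' a - v s s' b) - (v s s' a - a - (v s s' b - b)) by ring.
  exact: cabsB.
lra.
Qed.

Theorem half_plane_core xi : H xi -> exists2 K : R, 0 <= K &
  forall s t u, 0 <= s -> s <= t -> t <= u -> u <= T ->
    cabs (v s u xi - v s t xi) <= K * cabs (v 0 u c - v 0 t c).
Proof.
move=> Hxi; have Rxi : 0 < complex.Re xi by [].
have Rc : 0 < complex.Re c by [].
have [delta delta0 hd] := expansion.
(* Induction towards [s = 0] in steps of [delta], each costing a factor 2. *)
have steps (k : nat) s t u : 0 <= s -> s <= t -> t <= u -> u <= T -> s <= k%:R * delta ->
    cabs (v s u c - v s t c) <= 2 ^+ k * cabs (v 0 u c - v 0 t c).
  elim: k s t u => [|k IH] s t u s0 st tu uT.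
    rewrite mul0r => s0'; have -> : s = 0 by apply/eqP; rewrite eq_le s0'.
    by rewrite expr0 mul1r.
  rewrite -natr1 mulrDl mul1r => sk.
  pose s' := Num.max 0 (s - delta).
  have [s'0 s's s'k sd] : [/\ 0 <= s', s' <= s, s' <= k%:R * delta & s - s' <= delta].
    rewrite /s' le_max lexx /= !ge_max s0 /= mulr_ge0 // ?(ltW delta0) //=.
    split=> //; [lra|lra|].
    by rewrite lerBlDl -lerBlDr le_max lexx orbT.
  apply: le_trans (hd s' s t u s'0 s's st tu uT sd) _.
  by rewrite exprS -mulrA ler_wpM2l //; apply: IH => //; exact: le_trans st.
pose N := Num.Def.archi_bound (`|T| / delta).
have [M M0 hM] := half_plane_bounded Hxi.
pose L := (cabs xi + cabs c) ^+ 2 / (complex.Re xi * complex.Re c).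
have L0 : 0 <= L by rewrite divr_ge0 ?sqr_ge0 // mulr_ge0 // ltW.
(* [2 ^+ N] comes from [steps], [L] is Harnack's constant from [c] to [xi], and [M / Re xi] bounds
   the stretching of [v s t] between [xi] and [v t u xi], by Schwarz-Pick. *)
exists (M / complex.Re xi * (L * 2 ^+ N)) => [|s t u s0 st tu uT].
  by rewrite mulr_ge0 ?(divr_ge0 M0 (ltW Rxi)) // mulr_ge0 // exprn_ge0.
have t0 := le_trans s0 st; have tT := le_trans tu uT; have su := le_trans st tu.
have tN : t <= N%:R * delta.
  have := archi_boundP (divr_ge0 (normr_ge0 T) (ltW delta0)).
  by rewrite ltr_pdivrMr //; have := ler_norm T; rewrite -/N; lra.
(* Taking [s = t] in [steps], [v t t c = c] turns the increment into a displacement of [c]. *)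
have h1 : cabs (v t u c - c) <= 2 ^+ N * cabs (v 0 u c - v 0 t c).
  by have := steps N t t u t0 (lexx _) tu uT tN; rewrite (v_id t0 tT Hc).
have h2 : cabs (v t u xi - xi) <= L * (2 ^+ N * cabs (v 0 u c - v 0 t c)).
  rewrite /L mulrAC ler_pdivlMr ?mulr_gt0 //.
  apply: le_trans (incr_le t0 tu uT Hxi) _.
  by rewrite ler_wpM2l ?sqr_ge0.
have Hz : H (v t u xi) by exact: vH.
have sp := schwarz_pick (vd s0 st tT) (fun z hz => ltW (vH s0 st tT hz)) Hxi Hz.
rewrite -(v_comp s0 st tu uT Hxi) in sp.
have X2 : 2 * complex.Re xi <= cabs (v t u xi + xi^*%C).
  by apply: le_trans (Re_cabs _); rewrite !ReImE; have := vRe t0 tu uT Hxi; lra.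
have S2 : cabs (v s u xi + (v s t xi)^*%C) <= 2 * M.
  apply: le_trans (cabsD _ _) _; rewrite cabs_conj.
  by have := hM _ _ s0 su uT; have := hM _ _ s0 st tT; lra.
have h3 : cabs (v s u xi - v s t xi) * (2 * complex.Re xi) <=
    cabs (v t u xi - xi) * (2 * M).
  apply: le_trans (le_trans sp _); first by rewrite ler_wpM2l ?cabs_ge0.
  by rewrite ler_wpM2l ?cabs_ge0.
have h4 : cabs (v s u xi - v s t xi) * complex.Re xi <= cabs (v t u xi - xi) * M by lra.
have := ler_wpM2r M0 h2; move/(le_trans h4).
rewrite -ler_pdivlMr // => /le_trans; apply; rewrite le_eqVlt; apply/orP; left.
by apply/eqP; ring.
Qed.

End HalfPlaneCore.

(** * Moebius charts *)

Section SphereTopology.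
Variable R : realType.
Implicit Types (z s : C R) (D : domain).

Lemma nbhs_C (z : C R) (U : set (C R)) : nbhs z U <->
  exists2 d : R, 0 < d & forall w, cabs (w - z) < d -> U w.
Proof.
split=> [/nbhs_ballP[d /= d0 dU]|[d d0 dU]].
  have dE : d = (complex.Re d)%:C by rewrite RRe_real // gtr0_real.
  exists (complex.Re d) => [|w wz]; first by move: d0; rewrite dE ltcR.
  apply: dU; have zw : `|z - w| < d by rewrite cabsE dE ltcR cabsC.
  exact: zw.
apply/nbhs_ballP; exists d%:C => /=; first by rewrite ltcR.
move=> w zw; apply: dU; have : `|z - w| < d%:C := zw.
by rewrite cabsE ltcR cabsC.
Qed.

Lemma carrier_Disk z : carrier Disk z = (cabs z < 1) :> Prop.
Proof. by rewrite /= cabsE -(rmorph1 (real_complex R)) ltcR. Qed.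

Lemma carrier_open D z : carrier D z ->
  exists2 d : R, 0 < d & forall w, cabs (w - z) < d -> carrier D w.
Proof.
case: D => [|z0].
  rewrite carrier_Disk => z1; exists (1 - cabs z) => [|w wz]; first by lra.
  rewrite carrier_Disk; have := cabsD (w - z) z; rewrite subrK; lra.
exists (complex.Re z) => // w wz /=.
have := cabs_Re (w - z); rewrite !ReImE ler_norml => /andP[h _].
by move: z0 wz h => /=; lra.
Qed.

Lemma bd_Some D s : bd D (Some s) ->
  ~ carrier D s /\ forall e : R, 0 < e -> exists2 z, carrier D z & cabs (z - s) < e.
Proof.
move=> [cl nint]; split=> [Ds|e e0].
  apply: nint; apply: one_point_compactification_some_nbhs.
  by apply/nbhs_C; exact: carrier_open.
have : nbhs (Some s : sphere R) [set Some z | z in [set z | cabs (z - s) < e]].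
  by apply: one_point_compactification_some_nbhs; apply/nbhs_C; exists e.
by move=> /cl[_ [[z Dz <-] [z' /= z'e [z'z]]]]; exists z => //; rewrite -z'z.
Qed.

Lemma bd_Disk s : bd Disk (Some s) -> cabs s = 1.
Proof.
move=> /bd_Some[nD lim]; apply/eqP; rewrite eq_le; apply/andP; split.
  apply/ler_addgt0Pr => e /lim[z]; rewrite carrier_Disk => z1 zs.
  by have := cabsB z (z - s); rewrite subKr; lra.
by rewrite leNgt; apply/negP => s1; apply: nD; rewrite carrier_Disk.
Qed.

Lemma bd_HalfPlane s : bd HalfPlane (Some s) -> complex.Re s = 0.
Proof.
move=> /bd_Some[nD lim]; apply/eqP; rewrite eq_le; apply/andP; split.
  by rewrite leNgt; apply/negP => s1; apply: nD.
apply/ler_addgt0Pr => e /lim[z /= z0 zs].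
have := cabs_Re (z - s); rewrite !ReImE ler_norml => /andP[_ h].
by move: z0 zs h; rewrite /=; lra.
Qed.

(** Compactness comes from a product of two real segments. The square contains the unit disk, so its
    complement provides a neighbourhood of infinity that misses the disk. *)
Lemma unit_square_compact :
  compact [set z : C R | `|complex.Re z| <= 1 /\ `|complex.Im z| <= 1].
Proof.
pose f (p : R * R) : C R := p.1 +i* p.2.
have -> : [set z : C R | `|complex.Re z| <= 1 /\ `|complex.Im z| <= 1] =
    f @` (`[-1, 1]%classic `*` `[-1, 1]%classic).
  apply/seteqP; split=> [z [/= zr zi]|_ [[x y] /= [xr yi] <-]].
    exists (complex.Re z, complex.Im z); last by case: z {zr zi}.
    by split; rewrite /= in_itv /= -ler_norml.
  by move: xr yi; rewrite !in_itv /= -!ler_norml.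
apply: continuous_compact; last by apply: compact_setX; exact: segment_compact.
apply: continuous_subspaceT => -[x y] U /nbhs_C[d d0 dU].
exists (ball x (d / 2), ball y (d / 2)) => /=.
  by split; apply: nbhsx_ballx; rewrite divr_gt0.
move=> [x' y'] [/= xx' yy']; apply: dU; rewrite /f.
apply: le_lt_trans (cabs_le_ReIm _) _; rewrite !ReImE /=.
move: xx' yy'; rewrite /ball /= !(distrC _ x') !(distrC _ y'); lra.
Qed.

Lemma bd_Disk_None : ~ bd Disk (None : sphere R).
Proof.
pose W := [set z : C R | `|complex.Re z| <= 1 /\ `|complex.Im z| <= 1].
move=> [cl _]; have : nbhs (None : sphere R) ((Some @` (~` W)) `|` [set None]).
  exists W => //; split; first exact: unit_square_compact.
  apply: compact_closed; last exact: unit_square_compact.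
  exact: norm_hausdorff.
move=> /cl[_ [[z + <-]]]; rewrite carrier_Disk => z1 [[z' nW [z'z]]|//].
apply: nW; rewrite z'z; split; first by apply: le_trans (cabs_Re z) _; exact: ltW.
apply: ltW; apply: le_lt_trans z1; have := cabs_Re ('i * z).
by rewrite cabsM cabs_i mul1r ReImE /= mul0r mul1r sub0r normrN.
Qed.

Lemma angular_limit_Some D (f : C R -> C R) s a (M e : R) :
  angular_limit D f (Some s : sphere R) a -> 0 < e ->
  exists2 d : R, 0 < d &
    forall z, stolz D (Some s) M z -> cabs (z - s) < d -> cabs (f z - a) < e.
Proof.
move=> fa e0; have : nbhs a [set w | cabs (w - a) < e] by apply/nbhs_C; exists e.
move=> /(fa M)[U /nbhs_C[d d0 dU] UM]; exists d => // z Sz zs.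
by apply: (UM z) => //; exact: dU.
Qed.

(** The complement of a neighbourhood of infinity lies in a compact set, and a bound for the modulus
    there is the threshold [X]. *)
Lemma angular_limit_None (f : C R -> C R) a (M e : R) :
  angular_limit HalfPlane f (None : sphere R) a -> 0 < e ->
  exists X : R, forall z, stolz HalfPlane (None : sphere R) M z -> X < cabs z ->
    cabs (f z - a) < e.
Proof.
move=> fa e0; have : nbhs a [set w | cabs (w - a) < e] by apply/nbhs_C; exists e.
move=> /(fa M)[U [W [cW _] WU] UM].
have [B hB] : exists B, forall z, W z -> cabs z <= B.
  have ccabs : continuous (@cabs R : C R -> R).
    move=> z V /nbhs_ballP[d /= d0 dV]; apply/nbhs_C; exists d => // w wz.
    apply: dV; rewrite /ball /=; apply: le_lt_trans wz; rewrite ler_norml.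
    have := cabsD (w - z) z; have := cabsD (z - w) w; rewrite !subrK (cabsC z); lra.
  have /compact_bounded[B [Br hB]] := continuous_compact (continuous_subspaceT ccabs) cW.
  exists (B + 1) => z Wz; apply: le_trans (ler_norm _) _; apply: (hB (B + 1)).
    by rewrite ltrDl.
  by exists z.
exists B => z Sz zB; apply: (UM z) => //; apply: WU; left; exists z => //.
by move=> /hB; rewrite leNgt zB.
Qed.

End SphereTopology.

(** * Charts for the disk and the half-plane *)

Section Charts.
Variable R : realType.
Implicit Types (z w s : C R) (D : domain) (tau : sphere R).

(* [f] is a Moebius map of [D] onto the right half-plane sending [tau] to infinity,
   and [g] is its inverse; in the last field [l] is the inverse of the angular derivative
   at infinity of the conjugate of [m]. *)
Record half_plane_chart D tau (f g : C R -> C R) : Prop := HalfPlaneChart {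
  chart_Re : forall z, carrier D z -> 0 < complex.Re (f z);
  chart_inv_in : forall z, 0 < complex.Re z -> carrier D (g z);
  chartK : forall z, carrier D z -> g (f z) = z;
  chart_invK : forall z, 0 < complex.Re z -> f (g z) = z;
  chart_cdiff : forall z, carrier D z -> cdiff f z;
  chart_inv_cdiff : forall z, 0 < complex.Re z -> cdiff g z;
  chart_dist : forall z w, carrier D z -> carrier D w ->
    cabs (f z - f w) <= cabs (z - w) * ((1 + cabs (f z)) * (1 + cabs (f w)));
  chart_inv_dist : forall z w, 0 < complex.Re z -> 0 < complex.Re w ->
    cabs (g z - g w) <= cabs (z - w) * (2 + (complex.Re z * complex.Re w)^-1);
  chart_angular : forall m : C R -> C R, DW_point D m tau ->
    exists2 l : C R, complex.Re l <= 1 & forall e : R, 0 < e ->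
      exists2 X : R, 0 < X & forall x : R, X < x -> cabs (x%:C / f (m (g x%:C)) - l) < e }.

(** At infinity the angular derivative [a] is the limit of [m z / z], so [l] is [a^-1]; [1 <= a] in
    [C R] makes [a] real. The positive axis lies in the sector of aperture 1. *)
Lemma chart_HalfPlane_None : half_plane_chart HalfPlane None id id.
Proof.
split=> //.
- by move=> z _; exact: cdiff_id.
- by move=> z _; exact: cdiff_id.
- move=> z w _ _; rewrite ler_peMr ?cabs_ge0 //.
  by have := cabs_ge0 z; have := cabs_ge0 w => w0 z0; have := mulr_ge0 z0 w0; lra.
- move=> z w z0 w0; rewrite ler_peMr ?cabs_ge0 //.
  have : 0 < (complex.Re z * complex.Re w)^-1 by rewrite invr_gt0 mulr_gt0.
  by lra.
move=> w [_ _ [a [wa a1]]].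
have Rea : 1 <= complex.Re a by move: a1; rewrite lecE /= => /andP[].
have Ima : complex.Im a = 0 by move: a1; rewrite lecE /= => /andP[/eqP].
have ca : 1 <= cabs a by apply: le_trans (Re_cabs a).
have a0 : a != 0 by rewrite -cabs_gt0; lra.
exists a^-1.
  rewrite Re_inv; have -> : cabs a ^+ 2 = complex.Re a * complex.Re a.
    by rewrite sqr_cabs Ima; ring.
  have Ra0 : 0 < complex.Re a by lra.
  by rewrite invfM mulrA divff ?gt_eqF // mul1r invf_le1.
(* The bound [1 / 2] keeps [q] away from 0, since [|a| >= 1]. *)
move=> e e0; have eta0 : 0 < Num.min (1 / 2) (e / 2) by rewrite lt_min !divr_gt0.
have main (q : C R) : cabs (q - a) < Num.min (1 / 2) (e / 2) ->
    cabs (q^-1 - a^-1) < e.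
  rewrite lt_min => /andP[q1 q2].
  have q0 : 1 / 2 < cabs q by have := cabsB q (q - a); rewrite subKr; lra.
  have qn : q != 0 by rewrite -cabs_gt0; lra.
  have -> : q^-1 - a^-1 = - (q - a) / (q * a) by field; rewrite a0 qn.
  rewrite cabsM cabsN cabsV cabsM ltr_pdivrMr; last by apply: mulr_gt0; lra.
  apply: (lt_le_trans q2).
  have : e * (1 / 2 * 1) <= e * (cabs q * cabs a).
    by rewrite ler_pM2l //; apply: ler_pM; lra.
  lra.
have [X hX] := angular_limit_None 1 wa eta0.
exists (1 + `|X|) => [|x xX]; first by have := normr_ge0 X; lra.
have X0 := normr_ge0 X; have XX := ler_norm X.
have x0 : 0 < x by lra.
have /hX : stolz HalfPlane (None : sphere R) 1 x%:C.
  split=> //=; rewrite cabsE cabs_real gtr0_norm // -(rmorphM (real_complex R)) lecR.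
  by rewrite mul1r.
rewrite cabs_real gtr0_norm // => /(_ ltac:(lra)).
by move=> /main; rewrite invf_div.
Qed.

(** With [z = s + 1 / x], the quotient [x / f (m z)] is [(m z - s) / (z - s)], so [l] is the angular
    derivative. Such [z] lie on the normal at [s], where aperture 1 suffices. *)
Lemma chart_HalfPlane_Some s : complex.Re s = 0 ->
  half_plane_chart HalfPlane (Some s) (fun z => (z - s)^-1) (fun z => s + z^-1).
Proof.
move=> s0.
have ns z : 0 < complex.Re z -> z - s != 0.
  by move=> z0; apply: Re_neq0; rewrite !ReImE s0; lra.
have Re_f z : 0 < complex.Re z -> 0 < complex.Re (z - s)^-1.
  move=> z0; rewrite Re_inv divr_gt0 ?exprn_gt0 ?cabs_gt0 ?ns //.
  by rewrite !ReImE s0; lra.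
have Re_g z : 0 < complex.Re z -> 0 < complex.Re (s + z^-1).
  move=> z0; rewrite Re_add s0 add0r Re_inv divr_gt0 ?exprn_gt0 ?cabs_gt0 //.
  exact: Re_neq0.
split=> //.
- by move=> z z0; rewrite invrK addrC subrK.
- by move=> z z0; rewrite addrC addKr invrK.
- move=> z z0; apply: (cdiffV (f := fun z => z - s)); first exact: ns.
  by apply: cdiffB; [exact: cdiff_id|exact: cdiff_cst].
- move=> z z0; apply: cdiffD; first exact: cdiff_cst.
  by apply: (cdiffV (f := id)); [exact: Re_neq0|exact: cdiff_id].
- move=> z w z0 w0.
  have -> : (z - s)^-1 - (w - s)^-1 = - (z - w) * ((z - s)^-1 * (w - s)^-1).
    by field; rewrite !ns.
  rewrite !cabsM cabsN ler_wpM2l ?cabs_ge0 //.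
  by apply: ler_pM; rewrite ?cabs_ge0 // lerDr.
- move=> z w z0 w0.
  have zn : z != 0 by exact: Re_neq0.
  have wn : w != 0 by exact: Re_neq0.
  have -> : s + z^-1 - (s + w^-1) = - (z - w) * (z * w)^-1 by field; rewrite zn wn.
  rewrite cabsM cabsN ler_wpM2l ?cabs_ge0 // cabsV cabsM.
  have : (cabs z * cabs w)^-1 <= (complex.Re z * complex.Re w)^-1.
    rewrite lef_pV2 ?posrE ?mulr_gt0 ?cabs_gt0 //.
    by apply: ler_pM; rewrite ?Re_cabs // ltW.
  by lra.
move=> w [_ _ [a [wa a1]]]; exists a; first by move: a1; rewrite lecE /= => /andP[].
move=> e e0; have [d d0 hd] := angular_limit_Some 1 wa e0.
exists d^-1 => [|x xd]; first by rewrite invr_gt0.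
have x0 : 0 < x by apply: lt_trans xd; rewrite invr_gt0.
have E : s + (x%:C)^-1 - s = (x^-1)%:C :> C R by rewrite addrC addKr fmorphV.
have Ex : cabs (s + (x%:C)^-1 - s) = x^-1 by rewrite E cabs_real gtr0_norm ?invr_gt0.
have := hd (s + (x%:C)^-1); rewrite Ex invrK E fmorphV invrK.
rewrite [x%:C * _]mulrC; apply.
  split; first exact: Re_g.
  rewrite cabsE Ex /bd_dist Re_add s0 add0r -(rmorphM (real_complex R)) lecR mul1r.
  by rewrite -(fmorphV (real_complex R)).
by rewrite invf_plt ?posrE.
Qed.

(** This is the Cayley transform with pole at [t]; its inverse maps the positive axis into the
    diameter through [t]. *)
Lemma chart_Disk t : cabs t = 1 ->
  half_plane_chart Disk (Some t) (fun z => (t + z) / (t - z))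
    (fun z => t * (z - 1) / (z + 1)).
Proof.
move=> t1.
have tn : t != 0 by rewrite -cabs_gt0 t1.
have ntz z : cabs z < 1 -> t - z != 0.
  by apply: contraTneq => /eqP; rewrite subr_eq0 => /eqP <-; rewrite t1 ltxx.
have nz1 z : 0 < complex.Re z -> z + 1 != 0.
  by move=> z0; apply: Re_neq0; rewrite !ReImE /=; lra.
have z1_ge1 z : 0 < complex.Re z -> 1 <= cabs (z + 1).
  by move=> z0; apply: le_trans (Re_cabs _); rewrite !ReImE /=; lra.
have fd (z w : C R) : cabs z < 1 -> cabs w < 1 -> (t + z) / (t - z) - (t + w) / (t - w) =
    2 * t * (z - w) / ((t - z) * (t - w)).
  by move=> z1 w1; field; rewrite !ntz.
have f1 (z : C R) : cabs z < 1 -> (t + z) / (t - z) + 1 = 2 * t / (t - z).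
  by move=> z1; field; rewrite ntz.
have g_in z : 0 < complex.Re z -> cabs (t * (z - 1) / (z + 1)) < 1.
  move=> z0; rewrite !cabsM t1 mul1r cabsV ltr_pdivrMr ?mul1r ?cabs_gt0 ?nz1 //.
  rewrite -(ltr_pXn2r (isT : (0 < 2)%N)) ?nnegrE ?cabs_ge0 //.
  by have := sqr_cabs_conj z 1; rewrite conjc1 => ->; rewrite ltrDl /= mulr1 mulr_gt0.
have g_neg1 (z : C R) : z + 1 != 0 -> t * (z - 1) / (z + 1) - t = - (2 * t) / (z + 1).
  by move=> zn; field; rewrite zn.
split.
- move=> z; rewrite carrier_Disk => z1.
  have -> : complex.Re ((t + z) / (t - z)) =
      (cabs t ^+ 2 - cabs z ^+ 2) / cabs (t - z) ^+ 2.
    by rewrite Re_mul Re_inv Im_inv !sqr_cabs !ReImE; ring.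
  rewrite divr_gt0 ?exprn_gt0 ?cabs_gt0 ?ntz // t1 expr1n subr_gt0 expr_lt1 //.
  exact: cabs_ge0.
- by move=> z z0; rewrite carrier_Disk; exact: g_in.
- move=> z; rewrite carrier_Disk => z1; rewrite f1 //.
  have -> : (t + z) / (t - z) - 1 = 2 * z / (t - z) by field; rewrite ntz.
  by field; rewrite tn ntz.
- move=> z z0.
  have -> : t + t * (z - 1) / (z + 1) = 2 * t * z / (z + 1) by field; rewrite nz1.
  have -> : t - t * (z - 1) / (z + 1) = 2 * t / (z + 1) by field; rewrite nz1.
  by field; rewrite tn nz1.
- move=> z; rewrite carrier_Disk => z1; apply: cdiffM.
    by apply: cdiffD; [exact: cdiff_cst|exact: cdiff_id].
  apply: (cdiffV (f := fun z => t - z)); first exact: ntz.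
  by apply: cdiffB; [exact: cdiff_cst|exact: cdiff_id].
- move=> z z0; apply: cdiffM.
    apply: cdiffM; first exact: cdiff_cst.
    by apply: cdiffB; [exact: cdiff_id|exact: cdiff_cst].
  apply: (cdiffV (f := fun z => z + 1)); first exact: nz1.
  by apply: cdiffD; [exact: cdiff_id|exact: cdiff_cst].
- move=> z w; rewrite !carrier_Disk => z1 w1; rewrite fd //.
  (* [f u + 1 = 2 * t / (t - u)] expresses the closeness of [u] to [t] through the size of [f u]. *)
  have h (u : C R) : cabs u < 1 -> 2 * (cabs (t - u))^-1 <= 1 + cabs ((t + u) / (t - u)).
    move=> u1; have := cabsD ((t + u) / (t - u)) 1.
    have E : cabs (2 * t / (t - u)) = 2 * (cabs (t - u))^-1.
      by rewrite !cabsM cabs2 t1 mulr1 cabsV.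
    by rewrite f1 // E cabs1; lra.
  move: (h _ z1) (h _ w1); move: ((t + z) / (t - z)) ((t + w) / (t - w)) => A B hA hB.
  have -> : cabs (2 * t * (z - w) / ((t - z) * (t - w))) =
      cabs (z - w) * (2 * ((cabs (t - z))^-1 * (cabs (t - w))^-1)).
    by rewrite !cabsM cabs2 t1 mulr1 cabsV cabsM invfM; ring.
  rewrite ler_wpM2l ?cabs_ge0 //.
  have g0 (u : C R) : 0 <= (cabs u)^-1 by rewrite invr_ge0 cabs_ge0.
  have g2 (u : C R) : 0 <= 2 * (cabs u)^-1 by rewrite mulr_ge0.
  apply: le_trans (ler_pM (g2 _) (g2 _) hA hB).
  by have := mulr_ge0 (g0 (t - z)) (g0 (t - w)); lra.
- move=> z w z0 w0.
  have -> : t * (z - 1) / (z + 1) - t * (w - 1) / (w + 1) =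
      2 * t * (z - w) / ((z + 1) * (w + 1)) by field; rewrite !nz1.
  rewrite !cabsM cabs2 t1 mulr1 cabsV cabsM -mulrA mulrCA.
  rewrite ler_wpM2l ?cabs_ge0 //.
  have : 0 < (complex.Re z * complex.Re w)^-1 by rewrite invr_gt0 mulr_gt0.
  have zw : 1 * 1 <= cabs (z + 1) * cabs (w + 1) by apply: ler_pM; rewrite ?z1_ge1.
  rewrite mulr1 in zw.
  have : (cabs (z + 1) * cabs (w + 1))^-1 <= 1 by rewrite invf_le1 //; lra.
  lra.
move=> m [_ _ [a [ma a1]]]; exists a; first by move: a1; rewrite lecE /= => /andP[].
move=> e e0; pose K := cabs a + 1.
have K1 : 1 <= K by rewrite lerDr cabs_ge0.
have eta0 : 0 < Num.min 1 (e / 2) by rewrite lt_min !divr_gt0 ?ltr01.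
(* With [q = (m z - t) / (z - t)] and [dl = z - t] the expression is [x / f (m z)] at [z = g x]; it
   is close to [a] when [q] is and [dl] is small. *)
have main (q dl : C R) : cabs (q - a) < Num.min 1 (e / 2) -> K * cabs dl <= 1 ->
    K * (1 + K) * cabs dl <= e / 2 ->
    cabs (q * (2 * t + dl) / (2 * t + q * dl) - a) < e.
  rewrite lt_min => /andP[q1 q2] Kd KKd.
  have qK : cabs q <= K.
    by have := cabsD (q - a) a; rewrite subrK /K; lra.
  have qd : cabs (q * dl) <= 1.
    by rewrite cabsM; apply: le_trans Kd; rewrite ler_wpM2r ?cabs_ge0.
  have den : 1 <= cabs (2 * t + q * dl).
    have := cabsB (2 * t + q * dl) (q * dl); rewrite addrK cabsM cabs2 t1; lra.
  have dn : 2 * t + q * dl != 0 by rewrite -cabs_gt0; lra.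
  have -> : q * (2 * t + dl) / (2 * t + q * dl) - a =
      (q - a) + q * dl * (1 - q) / (2 * t + q * dl) by field; rewrite dn.
  apply: (le_lt_trans (cabsD _ _)).
  suff : cabs (q * dl * (1 - q) / (2 * t + q * dl)) <= e / 2 by lra.
  apply: le_trans KKd; rewrite !cabsM cabsV ler_pdivrMr; last by lra.
  have h1 : cabs (1 - q) <= 1 + K by apply: le_trans (cabsB _ _) _; rewrite cabs1; lra.
  have h2 : cabs q * cabs dl * cabs (1 - q) <= K * cabs dl * (1 + K).
    by apply: ler_pM; rewrite ?mulr_ge0 ?cabs_ge0 // ler_wpM2r ?cabs_ge0.
  apply: (le_trans h2).
  have : 0 <= K * (1 + K) * cabs dl by rewrite !mulr_ge0 ?cabs_ge0 //; lra.
  move=> h3; have := ler_wpM2l h3 den; lra.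
have [d d0 hd] := angular_limit_Some 1 ma eta0.
pose dd := Num.min d (Num.min K^-1 (e / 2 / (K * (1 + K)))).
have KK : 0 < K * (1 + K) by apply: mulr_gt0; lra.
have dd0 : 0 < dd by rewrite !lt_min d0 invr_gt0 !divr_gt0 //; lra.
have dd2 : 0 < 2 / dd by rewrite divr_gt0.
exists (1 + 2 / dd) => [|x xX]; first by lra.
have x0 : 0 < x by lra.
have Hx : 0 < complex.Re (x%:C : C R) by [].
have xn := nz1 _ Hx; set z := t * (x%:C - 1) / (x%:C + 1).
have zt : z - t = - (2 * t) / (x%:C + 1) by exact: g_neg1.
have x1E : cabs (x%:C + 1 : C R) = x + 1.
  by rewrite -(rmorph1 (real_complex R)) -(rmorphD (real_complex R)) cabs_real gtr0_norm ?addr_gt0.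
have czt : cabs (z - t) = 2 / (x + 1).
  by rewrite zt cabsM cabsN cabsM cabs2 t1 mulr1 cabsV x1E.
have small : cabs (z - t) < dd.
  rewrite czt ltr_pdivrMr ?addr_gt0 // mulrC -ltr_pdivrMr //; lra.
move: small; rewrite !lt_min => /andP[s1 /andP[s2 s3]].
have z1 : cabs z < 1 by exact: g_in.
have x10 : 0 < x + 1 by lra.
have cz : cabs z = (x - 1) / (x + 1).
  rewrite /z !cabsM cabsV x1E t1 mul1r; congr (_ / _).
  by rewrite -(rmorph1 (real_complex R)) -(rmorphB (real_complex R)) cabs_real ger0_norm //; lra.
(* On the radius [|z - t| = 1 - |z|], hence aperture 1. *)
have Sz : stolz Disk (Some t) 1 z.
  split; first by rewrite carrier_Disk.
  rewrite !cabsE /bd_dist -(rmorph1 (real_complex R)) cabsE -(rmorphB (real_complex R)).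
  rewrite -(rmorphM (real_complex R)) lecR mul1r cz czt le_eqVlt; apply/orP; left.
  by apply/eqP; field; rewrite gt_eqF.
have ztn : z - t != 0 by rewrite -cabs_gt0 czt divr_gt0.
have := main _ (z - t) (hd z Sz s1).
have -> : x%:C = (t + z) / (t - z).
  have -> : t + z = 2 * t * x%:C / (x%:C + 1) by rewrite /z; field; rewrite xn.
  have -> : t - z = 2 * t / (x%:C + 1) by rewrite /z; field; rewrite xn.
  by field; rewrite tn xn.
have -> : (m z - t) / (z - t) * (2 * t + (z - t)) / (2 * t + (m z - t) / (z - t) * (z - t)) =
   (t + z) / (t - z) / ((t + m z) / (t - m z)).
  rewrite divfK // invf_div.
  have -> : 2 * t + (m z - t) = t + m z by ring.
  have -> : 2 * t + (z - t) = t + z by ring.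
  have -> : t - z = - (z - t) by ring.
  by rewrite invrN; ring.
apply.
- by rewrite mulrC -ler_pdivlMr ?mul1r ?ltW //; lra.
- by rewrite mulrC -ler_pdivlMr // ltW.
Qed.

End Charts.

(** * Gluing densities along an exhaustion *)

Section Gluing.
Variable R : realType.
Notation mu := (@lebesgue_measure R).

(** [Bd t u c] abstracts an estimate by [c] over [[t, u]] that adds up over adjacent intervals. The
    density is [h k] on [[T k, T k.+1[], and an interval crossing grid points is split at the last
    one, by induction. *)
Lemma glue_density (I : set R) (Bd : R -> R -> R -> Prop) (T : nat -> R)
    (h : nat -> R -> R) :
  (forall x, I x -> 0 <= x) -> (forall x y, I x -> 0 <= y -> y <= x -> I y) ->
  T 0%N = 0 -> (forall k, T k < T k.+1) -> (forall x, I x -> exists k, x < T k) ->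
  (forall k r, 0 <= h k r) -> (forall k, mu.-integrable setT (EFin \o h k)) ->
  (forall t r u x y, I u -> 0 <= t -> t <= r -> r <= u ->
     Bd t r x -> Bd r u y -> Bd t u (x + y)) ->
  (forall k t u, I u -> T k <= t -> t <= u -> u <= T k.+1 ->
     Bd t u (\int[mu]_(r in `[t, u]) h k r)) ->
  exists f : R -> R, [/\ forall r, 0 <= f r, L1_loc I f &
    forall t u, I u -> 0 <= t -> t <= u -> Bd t u (\int[mu]_(r in `[t, u]) f r)].
Proof.
move=> I0 Iitv T0 TS Tex h0 hint Bcat Bloc.
have Tle k l : (k <= l)%N -> T k <= T l.
  by move=> /subnK <-; elim: (l - k)%N => // n IH; apply: le_trans IH (ltW (TS _)).
have Tge0 k : 0 <= T k by rewrite -T0 Tle.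
(* The default matters only outside all cells, where [f] merely has to be nonnegative. *)
pose n r := xget 0%N [set k | T k <= r < T k.+1].
have nE k r : T k <= r < T k.+1 -> n r = k.
  move=> kr; have : T (n r) <= r < T (n r).+1.
    by apply: (@xgetPex _ 0%N [set k | T k <= r < T k.+1]); exists k.
  move: kr => /andP[k1 k2] /andP[n1 n2].
  by case: (ltngtP (n r) k) => // /Tle h'; exfalso; lra.
have ex K r : 0 <= r -> r < T K -> exists2 k, (k < K)%N & T k <= r < T k.+1.
  elim: K => [|K IH] r0 rK; first by rewrite T0 in rK; lra.
  case: (ltP r (T K)) => h'; last by exists K => //; rewrite h'.
  by have [k kK kr] := IH r0 h'; exists k => //; exact: ltnW.
pose f r := h (n r) r; exists f.
have fE k r : T k <= r < T k.+1 -> f r = h k r by move=> /nE; rewrite /f => ->.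
have mh k : measurable_fun setT (h k).
  by apply/measurable_EFinP; have := measurable_int _ (hint k).
have mf : measurable_fun (\bigcup_k `[T k, T k.+1[%classic) f.
  apply/measurable_fun_bigcup => [k|k]; first exact: measurable_itv.
  apply: (@eq_measurable_fun _ _ _ _ _ (h k)); last exact: measurable_funS (mh k).
  by move=> r; rewrite inE /= in_itv /= => kr; rewrite (fE k).
have cover : [set r | 0 <= r /\ exists k, r < T k] `<=` \bigcup_k `[T k, T k.+1[%classic.
  move=> r /= [r0 [K rK]]; have [k _ kr] := ex K r r0 rK.
  by exists k => //=; rewrite in_itv.
have mcov : measurable (\bigcup_k `[T k, T k.+1[%classic : set R).
  by apply: bigcup_measurable => k _; exact: measurable_itv.
have Isub : I `<=` \bigcup_k `[T k, T k.+1[%classic.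
  by move=> r Ir; apply: cover; split; [exact: I0|exact: Tex].
have fint a b : 0 <= a -> (exists k, b < T k) -> mu.-integrable `[a, b] (EFin \o f).
  move=> a0 [K bK].
  have sub : `[a, b]%classic `<=` [set r | 0 <= r /\ exists k, r < T k].
    move=> r /=; rewrite in_itv /= => /andP[ar rb]; split; first by lra.
    by exists K; lra.
  (* Below [T K] the density is dominated by the finite sum of the [h k] with [k < K]. *)
  apply: (@le_integrable _ _ _ mu _ _ _ (fun r => (\sum_(k < K) (h k r)%:E)%E)).
  - exact: measurable_itv.
  - by apply/measurable_EFinP; apply: measurable_funS mf => //; exact: subset_trans cover.
  - move=> r rab /=; have [r0 _] := sub _ rab.
    have rK : r < T K by move: rab; rewrite /= in_itv /=; lra.
    have [k kK kr] := ex K r r0 rK; rewrite (fE k) // sumEFin lee_fin.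
    rewrite !ger0_norm //; last by apply: sumr_ge0.
    by rewrite (bigD1 (Ordinal kK)) //= lerDl sumr_ge0.
  - apply: integrable_sum => // k _; exact: integrableS (hint k).
have feq k t u : T k <= t -> t <= u -> u <= T k.+1 -> (exists l, u < T l) ->
    \int[mu]_(r in `[t, u]) h k r = \int[mu]_(r in `[t, u]) f r.
  move=> kt tu uk uT.
  have t0 : 0 <= t := le_trans (Tge0 k) kt.
  (* At [u = T k.+1] the function [f] already follows [h k.+1]; the right endpoint is dropped for
     this reason. *)
  rewrite -Rintegral_itv_bndo_bndc; last by apply: integrableS (hint k).
  rewrite -[RHS]Rintegral_itv_bndo_bndc; last first.
    apply: integrableS (fint t u t0 uT) => // r /=.
    by rewrite !in_itv /= => /andP[-> /ltW ->].
  apply: eq_Rintegral => r; rewrite inE /= in_itv /= => /andP[tr ru].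
  by rewrite (fE k) // (le_trans kt tr) (lt_le_trans ru uk).
split=> [r||]; [exact: h0|split|].
- exact: measurable_funS mf.
- move=> a b abI; case: (leP a b) => ab; last first.
    by rewrite set_itv_ge ?bnd_simp -?ltNge //; exact: integrable_set0.
  apply: fint; [apply: I0; apply: abI|apply: Tex; apply: abI].
    by rewrite /= in_itv /= lexx.
  by rewrite /= in_itv /= lexx ab.
have step k : forall t u, I u -> 0 <= t -> t <= u -> u <= T k ->
    Bd t u (\int[mu]_(r in `[t, u]) f r).
  elim: k => [|k IH] t u Iu t0 tu uk.
    rewrite T0 in uk; have uT1 := TS 0%N; rewrite T0 in uT1.
    rewrite -(feq 0%N) ?T0 //; [|lra|exact: Tex].
    by apply: Bloc; rewrite ?T0 //; lra.
  have uT := Tex _ Iu.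
  case: (leP u (T k)) => uk'; first exact: IH.
  case: (leP (T k) t) => tk; first by rewrite -(feq k) //; exact: Bloc.
  have IT : I (T k) by apply: Iitv Iu _ (ltW uk').
  have fsub : mu.-integrable `[t, u] (EFin \o f) by exact: fint.
  have := @Rintegral_itvB R f (BLeft t) (BRight u) (T k) fsub.
  rewrite !bnd_simp => /(_ (ltW tk) (ltW uk')).
  rewrite Rintegral_itv_obnd_cbnd; last first.
    apply: integrableS (fint (T k) u (Tge0 k) uT) => // r /=.
    by rewrite !in_itv /= => /andP[/ltW -> ->].
  move=> E; have -> : \int[mu]_(r in `[t, u]) f r =
     \int[mu]_(r in `[t, T k]) f r + \int[mu]_(r in `[T k, u]) f r by rewrite -E addrC subrK.
  apply: (Bcat _ (T k)) => //; try exact: ltW.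
    by apply: IH => //; exact: ltW.
  rewrite -(feq k (T k) u (lexx _) (ltW uk') uk uT).
  by apply: Bloc => //; exact: ltW.
move=> t u Iu t0 tu; have [k uk] := Tex _ Iu.
by apply: (step k) => //; exact: ltW.
Qed.

End Gluing.

(** * The increment estimate on a compact time interval *)

Section LocalEstimate.
Variable R : realType.
Implicit Types (z w : C R) (D : domain) (tau : sphere R) (I : set R).

Lemma half_plane_chart_exists D tau : bd D tau ->
  exists f g, half_plane_chart D tau f g.
Proof.
case: D; case: tau => [s|] bds.
- exists (fun z => (s + z) / (s - z)), (fun z => s * (z - 1) / (z + 1)).
  exact/chart_Disk/bd_Disk.
- by case: (bd_Disk_None bds).
- exists (fun z => (z - s)^-1), (fun z => s + z^-1).
  exact/chart_HalfPlane_Some/bd_HalfPlane.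
- by exists id, id; exact: chart_HalfPlane_None.
Qed.

Lemma chart_conj_cdiff D tau f g m : half_plane_chart D tau f g -> holo_self D m ->
  forall z, 0 < complex.Re z -> cdiff (fun z => f (m (g z))) z.
Proof.
move=> ch [mD md] z z0; have gz := chart_inv_in ch z0.
have mg : cdiff (fun z => m (g z)) z.
  by apply: cdiff_comp; [exact: (chart_inv_cdiff ch)|exact/derivable_cdiff/md].
by apply: (cdiff_comp mg); apply: (chart_cdiff ch); exact: mD.
Qed.

Lemma chart_julia D tau f g m : half_plane_chart D tau f g -> holo_self D m ->
  U_class D tau m -> forall z, carrier D z -> complex.Re (f z) <= complex.Re (f (m z)).
Proof.
move=> ch hm [mid|[_ DW]] z Dz; first by rewrite mid.
have [l l1 lim] := chart_angular ch DW.
have := julia (chart_conj_cdiff ch hm) _ l1 lim (chart_Re ch Dz).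
rewrite (chartK ch Dz); apply=> x x0; apply: (chart_Re ch).
by apply: hm.1; exact: (chart_inv_in ch).
Qed.

(** At a diagonal point [(r, r)] the map is the identity, and locally uniform convergence is used on
    the compact set [{z}]. Compactness of [[0, T]], as a near covering, makes [delta] independent of
    [s]. *)
Lemma topological_REF_near D I (v : R -> R -> C R -> C R) z (T e : R) :
  topological_REF D I v -> carrier D z -> (forall t, 0 <= t -> t <= T -> I t) -> 0 < e ->
  exists2 delta : R, 0 < delta & forall s t, 0 <= s -> s <= t -> t <= T ->
    t - s <= delta -> cabs (v s t z - z) < e.
Proof.
move=> [_ id_v _ cv] Dz IT e0.
have pt r : I r -> exists2 d : R, 0 < d & forall s t, Delta I (s, t) ->
    `|s - r| < d -> `|t - r| < d -> cabs (v s t z - z) < e.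
  move=> Ir; have Drr : Delta I (r, r) by split=> /=.
  have /fam_cvgP/(_ [set z]) := (subspace_continuousP _ _).1 cv (r, r) Drr.
  have kz : compactly_in (carrier (R := R) D) [set z].
    by split; [move=> _ ->|exact: compact_set1].
  move=> /(_ kz); rewrite uniform_set1 /= => czr.
  have : nbhs (v r r z) [set w | cabs (w - v r r z) < e] by apply/nbhs_C; exists e.
  move=> /czr [[U V] /= [/nbhs_ballP[d1 /= d10 U1] /nbhs_ballP[d2 /= d20 V2]] UV].
  exists (Num.min d1 d2) => [|s t Dst]; first by rewrite lt_min d10.
  rewrite !lt_min => /andP[s1 _] /andP[_ t2].
  have := UV (s, t); rewrite /= id_v //; apply=> //; split.
    by apply: U1; rewrite /ball /= distrC.
  by apply: V2; rewrite /ball /= distrC.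
have [T0|T0] := ltP T 0.
  by exists 1 => // s t s0 st tT; exfalso; lra.
have cover : near_covering (`[0, T]%classic : set R).
  exact/compact_near_coveringP/segment_compact.
pose P (delta s : R) := forall t, 0 <= s -> s <= t -> t <= T ->
    t - s <= delta -> cabs (v s t z - z) < e.
have := cover R (at_right 0) P _.
have loc r : `[0, T]%classic r -> \forall x' \near r & i \near at_right 0, P i x'.
  rewrite /= in_itv /= => /andP[r0 rT]; have [d d0 hd] := pt r (IT r r0 rT).
  exists (ball r (d / 2), [set i | i < d / 2]) => /=.
    split; first by apply: nbhsx_ballx; rewrite divr_gt0.
    by apply: nbhs_right_lt; rewrite divr_gt0.
  move=> [s i] /= [rs id] t s0 st tT tsi.
  have := hd s t; rewrite /ball /= in rs; apply.
  - by split=> //=; apply: IT => //; [exact: le_trans tT|exact: le_trans st].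
  - by rewrite distrC; lra.
  - by move: rs; rewrite !ltr_norml; lra.
move=> /(_ _ loc) near0.
have : \forall i \near at_right (0 : R), 0 < i /\ `[0, T]%classic `<=` P i.
  near=> i; split; first by near: i; exact: nbhs_right_gt.
  by near: i; exact: near0.
move=> /filter_ex[delta [delta0 hP]]; exists delta => // s t s0 st tT.
by apply: (hP s) => //; rewrite /= in_itv /= s0 (le_trans st).
Unshelve. all: by end_near. Qed.

(** The chart's distortion stays bounded along the family: the orbit of [f z0] is bounded, which
    controls the factor in [chart_dist], and real parts never drop below [Re (f z)], which controls
    the one in [chart_inv_dist]. *)
Lemma increments_le D tau I (v : R -> R -> C R -> C R) z0 z (T : R) :
  bd D tau -> 0 <= T -> (forall x, I x -> 0 <= x) -> (forall t, 0 <= t -> t <= T -> I t) ->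
  (forall s t : R, Delta I (s, t) -> U_class D tau (v s t)) ->
  topological_REF D I v -> carrier D z0 -> carrier D z ->
  exists2 K : R, 0 <= K & forall s t u, 0 <= s -> s <= t -> t <= u -> u <= T ->
    cabs (v s u z - v s t z) <= K * cabs (v 0 u z0 - v 0 t z0).
Proof.
move=> bdt T0 I0 IT Uv topv Dz0 Dz; have [f [g ch]] := half_plane_chart_exists bdt.
have [maps id_v comp_v _] := topv.
have Dlt s t : 0 <= s -> s <= t -> t <= T -> Delta I (s, t).
  by move=> s0 st tT; split=> //=; apply: IT => //; [exact: le_trans tT|exact: le_trans st].
pose V s t x := f (v s t (g x)).
have VE s t x : carrier D x -> V s t (f x) = f (v s t x) by move=> Dx; rewrite /V (chartK ch).
have vin s t x : 0 <= s -> s <= t -> t <= T -> carrier D x -> carrier D (v s t x).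
  by move=> s0 st tT; apply: (maps s t (Dlt _ _ s0 st tT)).1.
have Vd s t : 0 <= s -> s <= t -> t <= T -> forall x, 0 < complex.Re x -> cdiff (V s t) x.
  by move=> s0 st tT; exact: (chart_conj_cdiff ch (maps _ _ (Dlt _ _ s0 st tT))).
have VRe s t : 0 <= s -> s <= t -> t <= T -> forall x, 0 < complex.Re x ->
    complex.Re x <= complex.Re (V s t x).
  move=> s0 st tT x x0; have D1 := Dlt _ _ s0 st tT; rewrite -{1}(chart_invK ch x0).
  by apply: (chart_julia ch (maps _ _ D1) (Uv _ _ D1)); exact: (chart_inv_in ch).
have V_id s : 0 <= s -> s <= T -> forall x, 0 < complex.Re x -> V s s x = x.
  move=> s0 sT x x0; rewrite /V id_v ?(chart_invK ch) //; first exact: IT.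
  exact: (chart_inv_in ch).
have V_comp s t u : 0 <= s -> s <= t -> t <= u -> u <= T -> forall x, 0 < complex.Re x ->
    V s u x = V s t (V t u x).
  move=> s0 st tu uT x x0; have gx := chart_inv_in ch x0.
  have t0 := le_trans s0 st; have tT := le_trans tu uT.
  rewrite /V (chartK ch); last exact: vin.
  by rewrite -comp_v //; exact: Dlt.
have V_near e : 0 < e -> exists2 delta : R, 0 < delta &
    forall s t, 0 <= s -> s <= t -> t <= T -> t - s <= delta ->
      cabs (V s t (f z0) - f z0) <= e.
  move=> e0; have [eta eta0 heta] := cdiff_ccont (chart_cdiff ch Dz0) e0.
  have [delta delta0 hd] := topological_REF_near topv Dz0 IT eta0.
  exists delta => // s t s0 st tT tsd; rewrite VE //; apply/ltW/heta.
  exact: hd.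
have Hf0 := chart_Re ch Dz0; have Hfz := chart_Re ch Dz.
have [K K0 hK] := half_plane_core Vd VRe V_id V_comp V_near Hf0 Hfz.
have [M M0 hM] := half_plane_bounded Vd VRe V_id V_comp V_near Hf0 Hf0.
pose L := 2 + (complex.Re (f z) * complex.Re (f z))^-1.
have Rz2 : 0 < complex.Re (f z) * complex.Re (f z) by rewrite mulr_gt0.
have L0 : 0 <= L by rewrite addr_ge0 // invr_ge0 ltW.
exists (L * (K * ((1 + M) * (1 + M)))) => [|s t u s0 st tu uT].
  by rewrite !mulr_ge0 // addr_ge0.
have tT := le_trans tu uT; have su := le_trans st tu; have t0 := le_trans s0 st.
have u0 := le_trans t0 tu.
have Du := vin s u z s0 su uT Dz; have Dt := vin s t z s0 st tT Dz.
rewrite -(chartK ch Du) -(chartK ch Dt).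
have h1 := chart_inv_dist ch (chart_Re ch Du) (chart_Re ch Dt).
apply: (le_trans h1).
have Re_u : complex.Re (f z) <= complex.Re (f (v s u z)).
  by rewrite -VE //; exact: VRe.
have Re_t : complex.Re (f z) <= complex.Re (f (v s t z)).
  by rewrite -VE //; exact: VRe.
have h2 : 2 + (complex.Re (f (v s u z)) * complex.Re (f (v s t z)))^-1 <= L.
  rewrite lerD2l lef_pV2 ?posrE ?mulr_gt0 ?(lt_le_trans Hfz) //.
  by apply: ler_pM => //; exact: ltW.
have h3 := hK s t u s0 st tu uT; rewrite !VE // in h3.
have Dz0u := vin 0 u z0 (lexx _) u0 uT Dz0; have Dz0t := vin 0 t z0 (lexx _) t0 tT Dz0.
have h4 := chart_dist ch Dz0u Dz0t.
have h5 : (1 + cabs (f (v 0 u z0))) * (1 + cabs (f (v 0 t z0))) <= (1 + M) * (1 + M).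
  apply: ler_pM; rewrite ?addr_ge0 ?cabs_ge0 // lerD2l -VE //; exact: hM.
have h6 : cabs (f (v 0 u z0) - f (v 0 t z0)) <=
    cabs (v 0 u z0 - v 0 t z0) * ((1 + M) * (1 + M)).
  by apply: (le_trans h4); rewrite ler_wpM2l ?cabs_ge0.
apply: (@le_trans _ _ (K * (cabs (v 0 u z0 - v 0 t z0) * ((1 + M) * (1 + M))) * L)).
  apply: ler_pM => //; [exact: cabs_ge0| |].
    by rewrite addr_ge0 // invr_ge0 mulr_ge0 // ltW ?(lt_le_trans Hfz).
  by apply: (le_trans h3); rewrite ler_wpM2l.
by rewrite le_eqVlt; apply/orP; left; apply/eqP; ring.
Qed.

End LocalEstimate.

(** * Exhaustion of the time interval and conclusion *)

Section Main.
Variable R : realType.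
Notation mu := (@lebesgue_measure R).

Lemma AC_on_density (b : R) (G : R -> C R) : 0 <= b -> AC_on 0 b G ->
  exists h : R -> R, [/\ forall r, 0 <= h r, mu.-integrable setT (EFin \o h) &
    forall t u, 0 <= t -> t <= u -> u <= b ->
      cabs (G u - G t) <= \int[mu]_(r in `[t, u]) h r].
Proof.
(* For [b = 0] the interval is degenerate, a case that [ac_density] excludes. *)
rewrite le_eqVlt => /predU1P[<- _|b0 ac].
  exists (fun=> 0); split=> // [|t u t0 tu u0]; first exact: integrable0.
  have -> : u = t by lra.
  by rewrite subrr cabs0; exact: Rintegral_ge0.
apply: (@ac_density R (fun x y => cabs (G y - G x))) => //.
- by move=> x y; exact: cabs_ge0.
- by move=> x; rewrite subrr cabs0.
- move=> x y z; have -> : G z - G x = (G y - G x) + (G z - G y) by ring.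
  exact: cabsD.
move=> eps eps0; have [delta delta0 h] := ac _ eps0; exists delta => // T x y [xy dis].
have E (F : T -> R) : \sum_i F i = \sum_(i < #|T|) F (enum_val i) by exact: big_enum_val.
rewrite E (E (fun i => cabs _)) => len.
have := h _ (fun i : 'I_#|T| => x (enum_val i)) (fun i => y (enum_val i)) _ _ len.
have -> : \sum_(i < #|T|) `|G (y (enum_val i)) - G (x (enum_val i))| =
    (\sum_(i < #|T|) cabs (G (y (enum_val i)) - G (x (enum_val i))))%:C.
  by rewrite rmorph_sum; apply: eq_bigr => i _; exact: cabsE.
rewrite ltcR; apply=> [i|i j ij]; first exact: xy.
by apply: dis; rewrite (inj_eq enum_val_inj).
Qed.

(** The grid [T k] has to pass strictly beyond every point of [I], while [b k] stays in [I] and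
    bounds the part of [I] below [T k]. The two sequences differ when [I] is compact, because the
    grid then leaves [I]. *)
Lemma time_interval_exhaustion (I : set R) : time_interval I ->
  [/\ forall x, I x -> 0 <= x, forall x y, I x -> 0 <= y -> y <= x -> I y &
    exists T b : nat -> R, [/\ T 0%N = 0, forall k, T k < T k.+1,
      forall x, I x -> exists k, x < T k,
      forall k, I (b k) & forall k u, I u -> u <= T k -> u <= b k]].
Proof.
have bound_lt (x : R) : exists k : nat, x < k%:R.
  exists (Num.Def.archi_bound `|x|); apply: le_lt_trans (ler_norm x) _.
  exact: archi_boundP.
case=> -[].
  move=> T T0 ->; split=> [x /andP[]//|x y /= /andP[x0 xT] y0 yx|].
    by rewrite y0 (le_trans yx).
  exists (fun k => k%:R * (T + 1)), (fun=> T); split.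
  - by rewrite mul0r.
  - by move=> k; rewrite ltr_pM2r ?ltr_nat //; lra.
  - by move=> x /= /andP[x0 xT]; exists 1%N; rewrite mul1r; lra.
  - by move=> k /=; rewrite lexx ltW.
  - by move=> k u /= /andP[].
case=> [T| |] //=.
- rewrite lte_fin => T0 ->; split=> [x /= []//|x y /= [x0 xT] y0 yx|].
    by split=> //; rewrite lte_fin in xT *; exact: le_lt_trans xT.
  have TE k : T * (k%:R / k.+1%:R) = T - T / k.+1%:R.
    by rewrite -natr1; field; rewrite natr1 pnatr_eq0.
  exists (fun k => T * (k%:R / k.+1%:R)), (fun k => T * (k%:R / k.+1%:R)); split.
  - by rewrite mul0r mulr0.
  - move=> k; rewrite !TE ltrD2l ltrN2 ltr_pM2l // ltf_pV2 ?posrE ?ltr0n //.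
    by rewrite ltr_nat.
  - move=> x /= [x0]; rewrite lte_fin => xT.
    have [k hk] := bound_lt (T / (T - x)); exists k.
    rewrite TE ltrBrDr addrC -ltrBrDr ltr_pdivrMr ?ltr0n // mulrC -ltr_pdivrMr ?subr_gt0 //.
    by apply: lt_trans hk _; rewrite ltr_nat.
  - move=> k /=; rewrite lte_fin mulr_ge0 ?divr_ge0 ?(ltW T0) //; split=> //.
    by rewrite TE ltrBlDr ltrDl divr_gt0 // ltr0n.
  - by [].
- move=> _ ->; split=> [x /= []//|x y /= _ y0 _|]; first by rewrite ltry.
  exists (fun k => k%:R), (fun k => k%:R); split=> //.
  - by move=> k; rewrite ltr_nat.
  - by move=> k /=; rewrite ltry ler0n.
Qed.

End Main.

Theorem theorem5 (R : realType) (D : domain) (tau : sphere R) (I : set R)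
    (v : R -> R -> C R -> C R) :
  bd D tau ->
  time_interval I ->
  (forall s t : R, Delta I (s, t) -> U_class D tau (v s t)) ->
  topological_REF D I v ->
  (exists z0 : C R, carrier D z0 /\ AC_loc I (fun t : R => v 0%R t z0)) ->
  absolutely_continuous_REF D I v.
Proof.
move=> bdt /time_interval_exhaustion[I0 Iitv [T [b [T0 TS Tex Ib bT]]]] Uv topv [z0 [Dz0 ac]].
have [maps id_v comp_v _] := topv; split=> // z Dz.
(* Quantifying over [s] here makes one density serve all starting times. *)
pose Bd t u c := forall s, 0 <= s -> s <= t -> cabs (v s u z - v s t z) <= c.
have local_density k : exists h : R -> R, [/\ forall r, 0 <= h r,
    (@lebesgue_measure R).-integrable setT (EFin \o h) &
    forall t u, I u -> 0 <= t -> t <= u -> u <= T k.+1 ->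
      Bd t u (\int[@lebesgue_measure R]_(r in `[t, u]) h r)].
  have b0 := I0 _ (Ib k.+1).
  have Isub t : 0 <= t -> t <= b k.+1 -> I t by move=> t0; exact: Iitv (Ib _) t0.
  have [|h [h0 hint hle]] := AC_on_density b0 (G := fun t => v 0 t z0).
    by apply: ac => t; rewrite /= in_itv /= => /andP[]; exact: Isub.
  (* [K] belongs to the compact interval [[0, b k.+1]], which contains the part of [I] up to
     [T k.+1]. *)
  have [K K0 hK] := increments_le bdt b0 I0 Isub Uv topv Dz0 Dz.
  exists (fun r => K * h r); split=> [r||t u Iu t0 tu uT s s0 st].
  - exact: mulr_ge0.
  - exact: (integrableZl measurableT K hint).
  rewrite RintegralZl //; last exact: integrableS hint.
  have ub := bT _ _ Iu uT.
  apply: (le_trans (hK s t u s0 st tu ub)).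
  by rewrite ler_wpM2l //; exact: hle.
have Tge0 k : 0 <= T k by elim: k => [|k IH]; rewrite ?T0 // (le_trans IH) // ltW.
have [h hP] := choice local_density.
have [k r|k|t r u x y Iu t0 tr ru Btr Bru s s0 st|k t u Iu tk tu uk|f [f0 fL1 fle]] :=
  @glue_density R I Bd T h I0 Iitv T0 TS Tex.
- by have [] := hP k.
- by have [] := hP k.
- have -> : v s u z - v s t z = (v s r z - v s t z) + (v s u z - v s r z) by ring.
  apply: (le_trans (cabsD _ _)); apply: lerD; first exact: Btr.
  by apply: Bru => //; exact: le_trans tr.
- have [_ _ hle] := hP k; by apply: hle => //; exact: le_trans tk.
exists f; split=> [r _|//|s t u [/= Is It st] [/= _ Iu tu]]; first exact: f0.
by rewrite cabsE lecR; apply: fle => //; exact: I0.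
Qed.
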